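(* Let $(M,E)$ be a Finsler space with Chern connection $\overset{\ast}{D}$ and $h$-curvature $\overset{\ast}{R}$, and put $\overset{\ast}{R}(X,Y,Z,W):=g(\overset{\ast}{R}(X,Y)Z,JW)$. Then for all $X,Y,Z,W\in\mathfrak{X}(TM)$: (a) $\overset{\ast}{R}(X,Y,Z,W)=-\overset{\ast}{R}(Y,X,Z,W)$; (b) $\overset{\ast}{R}(X,Y,Z,W)+\overset{\ast}{R}(Y,Z,X,W)+\overset{\ast}{R}(Z,X,Y,W)=0$. Moreover, if $\mathfrak{R}=0$, then for all $X,Y,Z,W\in\mathfrak{X}(TM)$: (c) $\overset{\ast}{R}(X,Y,Z,W)=-\overset{\ast}{R}(X,Y,W,Z)$; (d) $\overset{\ast}{R}(X,Y,Z,W)=\overset{\ast}{R}(Z,W,X,Y)$.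
   Context: Setting. $M$ is a real $C^\infty$ manifold of finite dimension $n$, $TM$ its tangent bundle, $\mathcal{T}M$ the bundle of nonzero tangent vectors. $J$ is the natural almost-tangent structure (vertical endomorphism) of $TM$ (locally $J(\partial/\partial x^i)=\partial/\partial y^i$, $J(\partial/\partial y^i)=0$) and $C=y^i\partial/\partial y^i$ is the Liouville vector field. Brackets of vector forms are Frölicher-Nijenhuis brackets; for a vector $1$-form $L$ and vector field $X$, $[X,L]Y=[X,LY]-L[X,Y]$, $[L,X]=-[X,L]$. Finsler space $(M,E)$: $E:TM\to\mathbb{R}$ with $E>0$ on $\mathcal{T}M$, $E(0)=0$, $E$ $C^\infty$ on $\mathcal{T}M$ and $C^1$ on $TM$, $\mathcal{L}_CE=2E$, and $\Omega:=dd_JE$ of maximal rank, where $d_JE(X)=dE(JX)$. Canonical spray $S$: $i_S\Omega=-dE$. Barthel connection: $\Gamma=[J,S]$, with projectors $h=\frac12(I+\Gamma)$, $v=\frac12(I-\Gamma)$; its curvature is $\mathfrak{R}=-\frac12[h,h]$, i.e. $\mathfrak{R}(X,Y)=-v[hX,hY]$. The almost-complex structure $F$ is defined by $FJ=h$, $Fh=-J$; the metric is $g(X,Y)=\Omega(X,FY)$. $\mathcal{C}'$ is the symmetric vertical-valued bilinear tensor defined by $\Omega(\mathcal{C}'(X,Y),Z)=\frac12(\mathcal{L}_{hX}g)(JY,JZ)$. Regularity convention: objects built from $E$ are smooth only on $\mathcal{T}M$; linear connections on $TM$ and vector fields in $\mathfrak{X}(TM)$ are understood on $\mathcal{T}M$.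 Chern connection: the unique linear connection $\overset{\ast}{D}$ on $TM$ such that $\overset{\ast}{D}J=0$, $\overset{\ast}{D}C=v$, $\overset{\ast}{D}\Gamma=0$, $\overset{\ast}{D}_{JX}JY=J[JX,Y]$ (i.e. a normal lift of $\Gamma$), $\overset{\ast}{D}_{hX}g=0$, and $J\,\overset{\ast}{T}(hX,hY)=0$ for all $X,Y$, where $\overset{\ast}{T}$ is its classical torsion. Explicitly it is determined by $\overset{\ast}{D}_{JX}JY=J[JX,Y]$, $\overset{\ast}{D}_{hX}JY=v[hX,JY]+\mathcal{C}'(X,Y)$, $\overset{\ast}{D}F=0$. With $K(X,Y)Z=\overset{\ast}{D}_X\overset{\ast}{D}_YZ-\overset{\ast}{D}_Y\overset{\ast}{D}_XZ-\overset{\ast}{D}_{[X,Y]}Z$, the $h$-curvature is $\overset{\ast}{R}(X,Y)Z=K(hX,hY)JZ$. *)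

(* Defs.v *)
(* A tangent vector at a point q of an m-dimensional manifold is
   represented by its coordinates ('rV[R]_m) in a preferred chart
   [chart_at A q] around q; its coordinates in another chart are obtained by
   applying the derivative of the change of charts.  The tangent bundle is thus
   carried by the product M * 'rV[R]_n, its smooth structure being given by the
   usual induced charts (x, y), and a vector field is a function into 'rV[R]_m,
   its smoothness being tested in the charts. *)
From mathcomp Require Import all_boot all_order all_algebra.
From mathcomp Require Import boolp classical_sets functions cardinality.
From mathcomp Require Import reals topology normedtype derive.
Set Implicit Arguments.
Unset Strict Implicit.
Unset Printing Implicit Defensive.
Import Order.TTheory GRing.Theory Num.Theory.
Import numFieldNormedType.Exports.
Local Open Scope classical_set_scope.
Local Open Scope ring_scope.

(* For U open: all iterated partial derivatives of order at most k exist and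
   are continuous on U. *)
Fixpoint Ck (R : realType) (m k : nat) (U : set 'rV[R]_m)
    (f : 'rV[R]_m -> R) : Prop :=
  (forall x, U x -> {for x, continuous f}) /\
  match k with
  | 0%N => True
  | k'.+1 => forall i : 'I_m,
      (forall x, U x -> derivable f x (delta_mx 0 i)) /\
      Ck k' U ('D_(delta_mx 0 i) f)
  end.

Section Calculus.
Variables (R : realType) (T : choiceType) (m : nat).

Record chart := Chart { cdom : set T ; cmap : T -> 'rV[R]_m }.

Record atlas := Atlas { charts : set chart ; chart_at : T -> chart }.

(* Inverse of the chart c; p is a junk value used outside the image of c. *)
Definition cinv (c : chart) (p : T) (z : 'rV[R]_m) : T :=
  xget p [set q | cdom c q /\ cmap c q = z].

Definition transition (c c' : chart) (p : T) (z : 'rV[R]_m) : 'rV[R]_m :=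
  cmap c' (cinv c p z).

Variable A : atlas.

Definition Ck_fun (k : nat) (f : T -> R) : Prop :=
  forall c p, charts A c -> Ck k (cmap c @` cdom c) (f \o cinv c p).

Definition smooth_fun (f : T -> R) : Prop := forall k, Ck_fun k f.

(* Coordinates in the chart c of the tangent vector v at q. *)
Definition to_chart (c : chart) (q : T) (v : 'rV[R]_m) : 'rV[R]_m :=
  'D_v (transition (chart_at A q) c q) (cmap (chart_at A q) q).

(* The tangent vector at q whose coordinates in the chart c are w. *)
Definition of_chart (c : chart) (q : T) (w : 'rV[R]_m) : 'rV[R]_m :=
  'D_w (transition c (chart_at A q) q) (cmap c q).

Definition vfield := T -> 'rV[R]_m.

Definition vf_rep (c : chart) (p : T) (X : vfield) (z : 'rV[R]_m) : 'rV[R]_m :=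
  to_chart c (cinv c p z) (X (cinv c p z)).

Definition smooth_vf (X : vfield) : Prop :=
  forall c p (j : 'I_m) k, charts A c ->
    Ck k (cmap c @` cdom c) (fun z => vf_rep c p X z 0 j).

Definition vf_act (X : vfield) (f : T -> R) : T -> R :=
  fun p => 'D_(X p) (f \o cinv (chart_at A p) p) (cmap (chart_at A p) p).

Definition fscale (f : T -> R) (X : vfield) : vfield := fun p => f p *: X p.

Definition bracket (X Y : vfield) : vfield := fun p =>
  let c := chart_at A p in
  'D_(X p) (vf_rep c p Y) (cmap c p) - 'D_(Y p) (vf_rep c p X) (cmap c p).

(* The coordinate field d/dx^i of the chart around p, meaningful near p. *)
Definition coord_vf (p : T) (i : 'I_m) : vfield := fun q =>
  of_chart (chart_at A p) q (delta_mx 0 i).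

(* Vector 1-forms, seen as operators on vector fields. *)
Definition vector_form (L : vfield -> vfield) : Prop :=
  [/\ forall X, smooth_vf X -> smooth_vf (L X),
      forall X Y, smooth_vf X -> smooth_vf Y -> L (X + Y) = L X + L Y
    & forall f X, smooth_fun f -> smooth_vf X ->
        L (fscale f X) = fscale f (L X)].

(* [L, X] = - [X, L], where [X, L] Y = [X, L Y] - L [X, Y] *)
Definition fn_bracket_vf (L : vfield -> vfield) (X : vfield) : vfield -> vfield :=
  fun Y => - (bracket X (L Y) - L (bracket X Y)).

(* Froelicher-Nijenhuis bracket of two vector 1-forms; for K = L it is twice the
   Nijenhuis torsion of L. *)
Definition fn_bracket (K L : vfield -> vfield) (X Y : vfield) : vfield :=
  bracket (K X) (L Y) + bracket (L X) (K Y)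
  + K (L (bracket X Y)) + L (K (bracket X Y))
  - K (bracket (L X) Y) - K (bracket X (L Y))
  - L (bracket (K X) Y) - L (bracket X (K Y)).

Record linear_connection (D : vfield -> vfield -> vfield) : Prop := {
  lc_smooth : forall X Y, smooth_vf X -> smooth_vf Y -> smooth_vf (D X Y) ;
  lc_addl : forall X Y Z, smooth_vf X -> smooth_vf Y -> smooth_vf Z ->
    D (X + Y) Z = D X Z + D Y Z ;
  lc_addr : forall X Y Z, smooth_vf X -> smooth_vf Y -> smooth_vf Z ->
    D X (Y + Z) = D X Y + D X Z ;
  lc_scalel : forall f X Y, smooth_fun f -> smooth_vf X -> smooth_vf Y ->
    D (fscale f X) Y = fscale f (D X Y) ;
  lc_leibniz : forall f X Y, smooth_fun f -> smooth_vf X -> smooth_vf Y ->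
    D X (fscale f Y) = fscale (vf_act X f) Y + fscale f (D X Y) }.

Definition torsion (D : vfield -> vfield -> vfield) (X Y : vfield) : vfield :=
  D X Y - D Y X - bracket X Y.

Definition curvature (D : vfield -> vfield -> vfield) (X Y Z : vfield) : vfield :=
  D X (D Y Z) - D Y (D X Z) - D (bracket X Y) Z.

End Calculus.

Record smooth_manifold (R : realType) (M : topologicalType) (n : nat)
    (A : atlas R M n) : Prop := {
  sm_hausdorff : hausdorff_space M ;
  sm_countable : @second_countable M ;
  sm_chart_at : forall p, charts A (chart_at A p) ;
  sm_cdom_at : forall p, cdom (chart_at A p) p ;
  sm_cdom_open : forall c, charts A c -> open (cdom c) ;
  sm_inj : forall c, charts A c -> {in cdom c &, injective (cmap c)} ;
  sm_continuous : forall c p, charts A c -> cdom c p ->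
    {for p, continuous (cmap c)} ;
  (* openness of the chart and continuity of its inverse *)
  sm_open_map : forall c (V : set M), charts A c -> open V -> V `<=` cdom c ->
    open (cmap c @` V) ;
  sm_transition : forall c c' p (j : 'I_n) k, charts A c -> charts A c' ->
    Ck k (cmap c @` (cdom c `&` cdom c'))
       (fun z => transition c c' p z 0 j) }.

Section TangentBundle.
Variables (R : realType) (M : topologicalType) (n : nat) (A : atlas R M n).

Definition tangent : Type := (M * 'rV[R]_n)%type.

Definition tangent_chart (c : chart R M n) : chart R tangent (n + n) :=
  Chart [set u : tangent | cdom c u.1]
        (fun u : tangent => row_mx (cmap c u.1) (to_chart A c u.1 u.2)).

Definition tangent_atlas : atlas R tangent (n + n) :=
  Atlas (tangent_chart @` charts A)
        (fun u : tangent => tangent_chart (chart_at A u.1)).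

(* The bundle of nonzero tangent vectors. *)
Definition slit : Type := {u : tangent | u.2 != 0}.

Definition slit_chart (c : chart R M n) : chart R slit (n + n) :=
  Chart [set u : slit | cdom (tangent_chart c) (val u)]
        (fun u : slit => cmap (tangent_chart c) (val u)).

Definition slit_atlas : atlas R slit (n + n) :=
  Atlas (slit_chart @` charts A)
        (fun u : slit => slit_chart (chart_at A (val u).1)).

Definition liouville_tangent : vfield R tangent (n + n) :=
  fun u : tangent => row_mx 0 u.2.

Notation field := (vfield R slit (n + n)).
Notation "[[ X , Y ]]" := (bracket slit_atlas X Y) (at level 0).

Definition liouville : field := fun u => liouville_tangent (val u).

(* J (d/dx^i) = d/dy^i and J (d/dy^i) = 0 in the induced coordinates. *)
Definition vertical_endo (X : field) : field := fun u => row_mx 0 (lsubmx (X u)).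

Variable E : tangent -> R.

Definition dE (X : field) : slit -> R :=
  vf_act slit_atlas X (fun u : slit => E (val u)).

Definition dJE (X : field) : slit -> R := dE (vertical_endo X).

(* d (d_J E), by the invariant formula for the differential of a 1-form *)
Definition Omega (X Y : field) : slit -> R := fun u =>
  vf_act slit_atlas X (dJE Y) u - vf_act slit_atlas Y (dJE X) u
  - dJE [[X, Y]] u.

Record finsler : Prop := {
  fin_pos : forall u : tangent, u.2 != 0 -> 0 < E u ;
  fin_zero : forall p : M, E (p, 0) = 0 ;
  fin_smooth : smooth_fun slit_atlas (fun u : slit => E (val u)) ;
  fin_C1 : Ck_fun tangent_atlas 1 E ;
  fin_homog : forall u : tangent,
    vf_act tangent_atlas liouville_tangent E u = 2 * E u ;
  fin_rank : forall u : slit,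
    \rank (\matrix_(i < n + n, j < n + n)
      Omega (coord_vf slit_atlas u i) (coord_vf slit_atlas u j) u) = (n + n)%N }.

Definition canonical_spray (S : field) : Prop :=
  smooth_vf slit_atlas S /\
  forall X, smooth_vf slit_atlas X -> Omega S X = - dE X.

Variable S : field.

Definition barthel : field -> field := fn_bracket_vf slit_atlas vertical_endo S.

Definition hproj (X : field) : field := 2^-1 *: (X + barthel X).

Definition vproj (X : field) : field := 2^-1 *: (X - barthel X).

Definition barthel_curvature (X Y : field) : field :=
  - (2^-1 *: fn_bracket slit_atlas hproj hproj X Y).

(* The almost-complex structure: F J = h and F h = - J. *)
Definition almost_complex (F : field -> field) : Prop :=
  [/\ vector_form slit_atlas F,
      forall X, smooth_vf slit_atlas X -> F (vertical_endo X) = hproj X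
    & forall X, smooth_vf slit_atlas X -> F (hproj X) = - vertical_endo X].

Variable F : field -> field.

Definition gmetric (X Y : field) : slit -> R := Omega X (F Y).

Record chern_connection (D : field -> field -> field) : Prop := {
  ch_linear : linear_connection slit_atlas D ;
  ch_J : forall X Y, smooth_vf slit_atlas X -> smooth_vf slit_atlas Y ->
    D X (vertical_endo Y) = vertical_endo (D X Y) ;
  ch_C : forall X, smooth_vf slit_atlas X -> D X liouville = vproj X ;
  ch_Gamma : forall X Y, smooth_vf slit_atlas X -> smooth_vf slit_atlas Y ->
    D X (barthel Y) = barthel (D X Y) ;
  ch_vertical : forall X Y, smooth_vf slit_atlas X -> smooth_vf slit_atlas Y ->
    D (vertical_endo X) (vertical_endo Y)
    = vertical_endo [[vertical_endo X, Y]] ;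
  ch_metric : forall X Y Z, smooth_vf slit_atlas X -> smooth_vf slit_atlas Y ->
    smooth_vf slit_atlas Z ->
    vf_act slit_atlas (hproj X) (gmetric Y Z)
    = gmetric (D (hproj X) Y) Z + gmetric Y (D (hproj X) Z) ;
  ch_torsion : forall X Y, smooth_vf slit_atlas X -> smooth_vf slit_atlas Y ->
    vertical_endo (torsion slit_atlas D (hproj X) (hproj Y)) = 0 }.

Definition hcurvature (D : field -> field -> field) (X Y Z : field) : field :=
  curvature slit_atlas D (hproj X) (hproj Y) (vertical_endo Z).

Definition hcurvature4 (D : field -> field -> field) (X Y Z W : field) :
    slit -> R :=
  gmetric (hcurvature D X Y Z) (vertical_endo W).

End TangentBundle.

(* Main.v *)
Require Import Defs.
From HB Require Import structures.
From mathcomp Require Import all_boot all_order all_algebra.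
From mathcomp Require Import boolp classical_sets functions cardinality.
From mathcomp Require Import reals topology normedtype derive.
From mathcomp Require Import ssrAC.
From mathcomp Require Import landau realfun exp sequences.
From mathcomp Require Import ring lra.
Set Implicit Arguments.
Unset Strict Implicit.
Unset Printing Implicit Defensive.
Import Order.TTheory GRing.Theory Num.Theory.
Import numFieldNormedType.Exports.
Local Open Scope classical_set_scope.
Local Open Scope ring_scope.

(** Write [J] for the vertical endomorphism, [h] and [v] for the projectors of
    the Barthel connection and [K] for the curvature of the Chern connection
    [D], so that the h-curvature is [R(X, Y) Z = K(hX, hY) JZ].

    Four properties of [D] carry the proof.  First, [D] commutes with [J] and
    its horizontal torsion is killed by [J], so that
      [D_hX JU - D_hU JX = J [hX, hU]]      ([conn_symmetric]).
    Second, [D_W JZ = J [W, Z]] for every vertical field [W]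
    ([conn_vertical]).  Third, [D_hX g = 0].  Fourth, [g] is symmetric on
    vertical fields, because the Nijenhuis torsion of [J] vanishes
    ([metric_symmetric]).

    (a) is the antisymmetry of [K] in its first two arguments.  For (b), split
    [[hX, hY]] into its horizontal and vertical parts in the last term of [K]:
    with the first two properties the cyclic sum of [K(hX, hY) JZ] becomes [J]
    of the cyclic sum of [[hX, [hY, hZ]]], which is zero by the Jacobi identity
    ([hcurv_bianchi]).  When the Barthel curvature vanishes, [[hX, hY]] is
    horizontal ([horizontal_bracket]); then [K(hX, hY)] is a combination of
    derivatives along horizontal fields, all of which preserve [g], and since
    [[hX, hY]] acts on the function [g(JZ, JW)] as the commutator of [hX] and
    [hY], the endomorphism [K(hX, hY)] is skew-symmetric for [g], which is (c)
    ([curv4_antisym34]).  Finally (d) follows formally from (a), (b) and (c)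
    ([curvature_pair_symmetry]).

    This argument is pure algebra; its axioms are collected in the record
    [chern_algebra], and [finsler_chern_algebra] shows that a Finsler space
    satisfies them.  The analysis needed there is of two kinds.

    Lie brackets are defined by coordinates in one chart at each point.  That
    they have the expected form in every chart ([bracket_chart]), satisfy the
    Jacobi identity ([jacobi]) and act on functions as commutators
    ([vf_act_bracket]) all come from the symmetry of second derivatives
    ([schwarz], [derive_commutator]).

    The axiom [D_JX JY = J [JX, Y]] concerns only the fields of the form [JX]
    with [X] smooth on the whole slit bundle.  In a chart every
    vertical field is visibly of this form, and multiplication by a bump
    function makes this a global statement ([vertical_local]); this is why
    smooth functions with compact support in a chart are constructed
    ([exists_bump]).  That [vX] is vertical follows from the axioms [D C = v]
    and [D J = 0], since [J(vX) = J(D_X C) = D_X(JC) = 0] ([J_vproj]), and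
    [h] is idempotent because [h(hX) = F(J(hX)) = F(JX) = hX]
    ([hproj_idem]). *)

(** * Directional derivatives in coordinate spaces *)

Section Directional.
Variables (R : realType) (m : nat).
Implicit Types (f : 'rV[R]_m -> R) (x v w : 'rV[R]_m).

Lemma rV_norm_le (u : 'rV[R]_m) (a : R) :
  0 <= a -> (forall i, `|u 0 i| <= a) -> `|u| <= a.
Proof.
move=> a0 ua; rewrite [leLHS]/Num.Def.normr/= mx_normrE.
by rewrite (bigmax_le _ a0)//= => -[i j] _ /=; rewrite (ord1 i).
Qed.

Lemma coord_norm_le (u : 'rV[R]_m) i : `|u 0 i| <= `|u|.
Proof.
rewrite [leRHS]/Num.Def.normr/= mx_normrE.
exact: (le_bigmax _ (fun ij => `|u ij.1 ij.2|) (0, i)).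
Qed.

Lemma dist_both (a b c e : R) :
  `|a - c| < e / 2 -> `|b - c| < e / 2 -> `|a - b| <= e.
Proof.
move=> ac bc; rewrite (le_trans (ler_distD c _ _))// (splitr e) lerD ?ltW//.
by rewrite distrC.
Qed.

Lemma derivable_line f x v t : derivable f (x + t *: v) v ->
  is_derive t (1 : R) (fun s : R => f (x + s *: v)) ('D_v f (x + t *: v)).
Proof.
have E : (fun h : R => h^-1 *: (((fun s : R => f (x + s *: v)) \o shift t) (h *: (1 : R))
              - f (x + t *: v))) =
         (fun h : R => h^-1 *: ((f \o shift (x + t *: v)) (h *: v) - f (x + t *: v))).
  apply/funext => h /=; congr (_ *: (f _ - _)).
  by rewrite [h *: (1 : R)]mulr1 scalerDl addrCA.
move=> df; apply: DeriveDef.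
  by rewrite /derivable; move: df; rewrite /derivable -E.
by rewrite /derive -E.
Qed.

(** A function need only be affine along the line through [x] directed by [v]:
    this gives the derivatives of maps that are linear in some of their
    variables. *)
Lemma derive_affine (V : normedModType R) (f : 'rV[R]_m -> V) x v a :
  (forall h : R, f (h *: v + x) = f x + h *: a) -> 'D_v f x = a.
Proof.
move=> E; rewrite /derive; apply/lim_near_cst => //=.
near=> h; rewrite E addrC addKr scalerA mulVf ?scale1r//.
by near: h; exact: nbhs_dnbhs_neq.
Unshelve. all: by end_near. Qed.

(** The sign of [h] is arbitrary: increments of coordinates have no sign. *)
Lemma mvt_line f x v (h : R) :
  (forall t : R, `|t| <= `|h| -> derivable f (x + t *: v) v) ->
  exists2 t, `|t| <= `|h| & f (x + h *: v) - f x = h * 'D_v f (x + t *: v).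
Proof.
move=> df; pose g (s : R) := f (x + s *: v).
have dg (s : R) : `|s| <= `|h| -> is_derive s (1 : R) g ('D_v f (x + s *: v)).
  by move=> sh; apply: derivable_line; exact: df.
have g0 : g 0 = f x by rewrite /g scale0r addr0.
have cg a b : (forall s, s \in `[a, b] -> `|s| <= `|h|) ->
    {within `[a, b], continuous g}.
  move=> ab; apply: derivable_within_continuous => s sab.
  by have [] := dg s (ab _ sab).
have [h0|h0] := leP 0 h.
  have ab s : s \in `[0, h] -> `|s| <= `|h|.
    by rewrite in_itv/= => /andP[s0 sh]; rewrite !ger0_norm.
  have [|t tab E] :=
    @MVT_segment R g (fun s => 'D_v f (x + s *: v)) 0 h h0 _ (cg _ _ ab).
    by move=> s /subset_itv_oo_cc sab; exact: dg (ab _ sab).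
  by exists t; [exact: ab|rewrite -g0 -/(g h) E subr0 mulrC].
have ab s : s \in `[h, 0] -> `|s| <= `|h|.
  by rewrite in_itv/= => /andP[s0 sh]; rewrite !ler0_norm ?lerN2// ltW.
have [|t tab E] :=
  @MVT_segment R g (fun s => 'D_v f (x + s *: v)) h 0 (ltW h0) _ (cg _ _ ab).
  by move=> s /subset_itv_oo_cc sab; exact: dg (ab _ sab).
by exists t; [exact: ab|rewrite -g0 -/(g h) -opprB E sub0r mulrN opprK mulrC].
Qed.

Lemma shift_derive f a v x :
  'D_v (fun y => f (y + a)) x = 'D_v f (x + a).
Proof.
rewrite /derive (_ : (fun h => _) =
  (fun h => h^-1 *: ((f \o shift (x + a)) (h *: v) - f (x + a))))//.
by apply/funext => h /=; rewrite addrA.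
Qed.

Lemma shift_derivable f a v x :
  derivable f (x + a) v -> derivable (fun y => f (y + a)) x v.
Proof.
rewrite /derivable => df; rewrite (_ : (fun h => _) =
  (fun h => h^-1 *: ((f \o shift (x + a)) (h *: v) - f (x + a))))//.
by apply/funext => h /=; rewrite addrA.
Qed.

Opaque derive derivable.

(** The second difference on the left is symmetric in [v] and [w], whereas the
    right-hand side distinguishes the order of the two derivations: comparing the
    two orders is what proves the symmetry of second derivatives. *)
Lemma second_difference f x v w (r h : R) :
  (forall y, `|y - x| < r -> derivable f y v /\ derivable ('D_v f) y w) ->
  `|h| * (`|v| + `|w|) < r ->
  exists2 y, `|y - x| <= `|h| * (`|v| + `|w|) &
    f (x + h *: v + h *: w) - f (x + h *: v) - (f (x + h *: w) - f x)
    = h ^+ 2 * 'D_w ('D_v f) y.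
Proof.
move=> df hr; pose g y := f (y + h *: w) - f y.
have near_x s t : `|s| <= `|h| -> `|t| <= `|h| ->
    `|x + s *: v + t *: w - x| <= `|h| * (`|v| + `|w|).
  move=> sh th; rewrite -[x + _ + _]addrA [_ - x]addrC addKr mulrDr.
  by rewrite (le_trans (ler_normD _ _))// !normrZ lerD// ler_wpM2r.
have near_x' s : `|s| <= `|h| -> `|x + s *: v - x| <= `|h| * (`|v| + `|w|).
  by move=> sh; have := near_x s 0 sh; rewrite scale0r addr0 normr0; exact.
have fr y : `|y - x| <= `|h| * (`|v| + `|w|) -> `|y - x| < r.
  by move=> H; exact: le_lt_trans hr.
have d1 s : `|s| <= `|h| -> derivable (fun y => f (y + h *: w)) (x + s *: v) v.
  by move=> sh; apply: shift_derivable; apply: (df _ (fr _ _)).1; exact: near_x.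
have d2 s : `|s| <= `|h| -> derivable f (x + s *: v) v.
  by move=> sh; apply: (df _ (fr _ _)).1; exact: near_x'.
have [s sh E] : exists2 s, `|s| <= `|h| &
    g (x + h *: v) - g x = h * 'D_v g (x + s *: v).
  by apply: mvt_line => t th; apply: derivableB; [exact: d1|exact: d2].
have [t th E2] : exists2 t, `|t| <= `|h| &
    'D_v f (x + s *: v + h *: w) - 'D_v f (x + s *: v)
    = h * 'D_w ('D_v f) (x + s *: v + t *: w).
  apply: (@mvt_line ('D_v f) (x + s *: v) w h) => t th.
  by apply: (df _ (fr _ _)).2; exact: near_x.
exists (x + s *: v + t *: w); first exact: near_x.
rewrite -/(g (x + h *: v)) -/(g x) E deriveB//; [|exact: d1|exact: d2].
by rewrite shift_derive E2 mulrA.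
Qed.

Lemma schwarz f x v w :
  (\forall y \near x, [/\ derivable f y v, derivable f y w,
     derivable ('D_v f) y w & derivable ('D_w f) y v]) ->
  {for x, continuous ('D_w ('D_v f))} -> {for x, continuous ('D_v ('D_w f))} ->
  'D_w ('D_v f) x = 'D_v ('D_w f) x.
Proof.
move=> df cwv cvw; apply/eqP; rewrite -subr_eq0 -normr_le0.
apply/ler_addgt0Pr => e e0; rewrite add0r.
have e2 : 0 < e / 2 by rewrite divr_gt0.
move/nbhs_ballP : df => -[r1 /= r10 df].
move/cvgrPdist_lt : cwv => /(_ _ e2) /nbhs_ballP [r2 /= r20 cwv].
move/cvgrPdist_lt : cvw => /(_ _ e2) /nbhs_ballP [r3 /= r30 cvw].
pose r := Num.min r1 (Num.min r2 r3).
have r0 : 0 < r by rewrite !lt_min r10 r20.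
have rP y : `|y - x| < r -> [/\ ball x r1 y, ball x r2 y & ball x r3 y].
  by rewrite -!ball_normE /= distrC !lt_min => /and3P[].
(* The summand 1 covers the case where both directions are zero. *)
pose h := r / (2 * (`|v| + `|w| + 1)).
have nz : 0 < `|v| + `|w| + 1 by rewrite ltr_wpDl// addr_ge0.
have dr u : `|u - x| < r -> [/\ derivable f u v, derivable f u w,
     derivable ('D_v f) u w & derivable ('D_w f) u v].
  by move=> ur; have [b1 _ _] := rP u ur; exact: df b1.
have h0 : 0 < h by rewrite divr_gt0// mulr_gt0.
have hr : `|h| * (`|v| + `|w|) < r.
  rewrite gtr0_norm// /h mulrAC ltr_pdivrMr ?mulr_gt0// ltr_pM2l//.
  have : 0 <= `|v| by []. have : 0 <= `|w| by [].
  by lra.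
have hr' : `|h| * (`|w| + `|v|) < r by rewrite [`|w| + _]addrC.
have [y yx Ey] : exists2 y, `|y - x| <= `|h| * (`|v| + `|w|) &
    f (x + h *: v + h *: w) - f (x + h *: v) - (f (x + h *: w) - f x)
    = h ^+ 2 * 'D_w ('D_v f) y.
  have H u : `|u - x| < r -> derivable f u v /\ derivable ('D_v f) u w.
    by move=> ur; have [] := dr u ur.
  exact: (@second_difference f x v w r h H hr).
have [z zx Ez] : exists2 z, `|z - x| <= `|h| * (`|w| + `|v|) &
    f (x + h *: w + h *: v) - f (x + h *: w) - (f (x + h *: v) - f x)
    = h ^+ 2 * 'D_v ('D_w f) z.
  have H u : `|u - x| < r -> derivable f u w /\ derivable ('D_w f) u v.
    by move=> ur; have [] := dr u ur.
  exact: (@second_difference f x w v r h H hr').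
have yz : 'D_w ('D_v f) y = 'D_v ('D_w f) z.
  have h2 : h ^+ 2 != 0 by rewrite expf_neq0// gt_eqF.
  apply: (mulfI h2); apply: etrans (esym Ey) (etrans _ Ez).
  rewrite (addrAC x); move: (f _) (f _) (f _) (f _) => a b c d.
  by ring.
have Hy : `|'D_w ('D_v f) x - 'D_w ('D_v f) y| < e / 2.
  by have [_ b2 _] := rP _ (le_lt_trans yx hr); exact: cwv b2.
have Hz : `|'D_v ('D_w f) x - 'D_v ('D_w f) z| < e / 2.
  by have [_ _ b3] := rP _ (le_lt_trans zx hr'); exact: cvw b3.
rewrite -yz in Hz.
exact: dist_both Hy Hz.
Qed.

(** Continuous partial derivatives give a total derivative: move from [x] to
    [x + h] one coordinate at a time and apply the mean value theorem on each
    of the segments, all of which stay in the ball of radius [`|h|]. *)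
Lemma differentiable_partials f x :
  (\forall y \near x, forall i, derivable f y (delta_mx 0 i)) ->
  (forall i, {for x, continuous ('D_(delta_mx 0 i) f)}) ->
  differentiable f x.
Proof.
move=> df cf.
pose L (h : 'rV[R]_m) : R := \sum_i h 0 i * 'D_(delta_mx 0 i) f x.
have L_lin : linear L.
  move=> a u v; rewrite /L scaler_sumr -big_split/=; apply: eq_bigr => i _.
  by rewrite !mxE mulrDl -mulrA.
pose Lm := GRing.isLinear.Build _ _ _ _ L L_lin.
pose LL : {linear 'rV[R]_m -> R} := HB.pack L Lm.
have cL : continuous L.
  apply: continuous_big => [|i _ y]; first exact: add_continuous.
  apply: (@continuousM _ _ (fun h : 'rV[R]_m => h 0 i) (cst _)).
    exact: coord_continuous.
  exact: cst_continuous.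
suff O : f \o shift x = cst (f x) + (L : _ -> R^o) +o_ (0 : 'rV[R]_m) id.
  by apply/diff_locallyP; rewrite (@diff_unique _ _ _ f LL x cL O).
apply/eqaddoP => e e0.
have em : 0 < e / m.+1%:R by rewrite divr_gt0.
move/nbhs_ballP : df => -[r1 /= r10 df].
have /nbhs_ballP[r2 /= r20 cf2] : \forall y \near x, forall i,
    `|'D_(delta_mx 0 i) f x - 'D_(delta_mx 0 i) f y| < e / m.+1%:R.
  have := @filter_forall _ 'I_m (fun i y =>
    `|'D_(delta_mx 0 i) f x - 'D_(delta_mx 0 i) f y| < e / m.+1%:R) (nbhs x) _.
  apply => i.
  by move/cvgrPdist_lt : (cf i) => /(_ _ em).
apply/nbhs_ballP; exists (Num.min r1 r2); first by rewrite /= lt_min r10.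
move=> h; rewrite -ball_normE /= sub0r normrN lt_min => /andP[h1 h2].
rewrite !fctE /=.
pose tr (k : nat) : 'rV[R]_m := \row_i (if (i < k)%N then h 0 i else 0).
have trS (k : 'I_m) : tr k.+1 = tr k + h 0 k *: delta_mx 0 k.
  apply/rowP => i; rewrite !mxE eqxx/= ltnS leq_eqVlt val_eqE.
  by case: eqVneq => [->|] /=; rewrite ?ltnn ?mulr1 ?add0r ?mulr0 ?addr0.
have tr_le (k : 'I_m) t : `|t| <= `|h 0 k| ->
    `|tr k + t *: delta_mx 0 k| <= `|h|.
  move=> th; apply: rV_norm_le => // i; rewrite !mxE eqxx/=.
  have [->|] := eqVneq i k.
    by rewrite ltnn mulr1 add0r (le_trans th)// coord_norm_le.
  by case: ifP => _ _; rewrite mulr0 ?addr0 ?normr0// coord_norm_le.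
have step (k : 'I_m) : exists2 t, `|t| <= `|h 0 k| &
    f (x + tr k.+1) - f (x + tr k)
    = h 0 k * 'D_(delta_mx 0 k) f (x + tr k + t *: delta_mx 0 k).
  rewrite trS addrA; apply: mvt_line => t th; apply: df.
  rewrite -ball_normE /= -addrA opprD addNKr normrN.
  by rewrite (le_lt_trans _ h1)// tr_le.
have -> : f (h + x) - (f x + LL h)
    = \sum_(k < m) ((f (x + tr k.+1) - f (x + tr k))
                   - h 0 k * 'D_(delta_mx 0 k) f x).
  rewrite sumrB -(big_mkord xpredT (fun k => f (x + tr k.+1) - f (x + tr k))).
  rewrite telescope_sumr// opprD addrA; congr (_ - _ - _).
    congr f; rewrite addrC; congr (_ + _); apply/rowP => i.
    by rewrite mxE ltn_ord.
  by congr f; rewrite -[LHS]addr0; congr (_ + _); apply/rowP => i; rewrite !mxE.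
rewrite (le_trans (ler_norm_sum _ _ _))//.
rewrite (@le_trans _ _ (\sum_(k < m) e / m.+1%:R * `|h|))//.
  apply: ler_sum => k _; have [t th ->] := step k.
  rewrite -mulrBr normrM mulrC ler_pM ?coord_norm_le// ltW// distrC cf2//.
  rewrite -ball_normE /= -addrA opprD addNKr normrN.
  by rewrite (le_lt_trans _ h2)// tr_le.
rewrite sumr_const card_ord -[leLHS]mulr_natr [leLHS]mulrAC ler_wpM2r//.
by rewrite -mulrA ler_piMr ?(ltW e0)// ler_pdivrMl// mulr1 ler_nat.
Qed.

End Directional.

(** * Functions with continuous iterated partial derivatives *)

Section CkCalculus.
Variables (R : realType) (m : nat).
Implicit Types (U V : set 'rV[R]_m) (f g : 'rV[R]_m -> R).

Lemma open_near U (P : 'rV[R]_m -> Prop) x :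
  open U -> U x -> (forall y, U y -> P y) -> \forall y \near x, P y.
Proof. by move=> oU Ux UP; apply: filterS UP _; exact: open_nbhs_nbhs. Qed.

Lemma near_eq_continuous f g x :
  (\forall y \near x, f y = g y) -> {for x, continuous f} -> {for x, continuous g}.
Proof.
move=> fg cf; rewrite /prop_for /continuous_at -(nbhs_singleton fg).
apply: cvg_trans cf; have gf : {near nbhs x, f =1 g} := fg.
exact: (near_eq_cvg gf).
Qed.

Lemma Ck_cont k U f x : Ck k U f -> U x -> {for x, continuous f}.
Proof. by case: k => [|k] [cf _]; exact: cf. Qed.

Lemma CkW k U f : Ck k.+1 U f -> Ck k U f.
Proof.
elim: k f => [|k IH] f [cf df]; first by split.
by split => // i; have [? ?] := df i; split => //; exact: IH.
Qed.

Lemma Ck_sub k U V f : U `<=` V -> Ck k V f -> Ck k U f.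
Proof.
move=> UV; elim: k f => [|k IH] f [cf df]; split=> //.
- by move=> x /UV; exact: cf.
- by move=> x /UV; exact: cf.
- by move=> i; have [d c] := df i; split; [move=> x /UV; exact: d|exact: IH].
Qed.

Lemma Ck_local k U f :
  (forall x, U x -> exists2 V, V x & Ck k V f) -> Ck k U f.
Proof.
elim: k f => [|k IH] f lf.
  by split => // x /lf[V Vx fV]; exact: Ck_cont fV Vx.
split; first by move=> x /lf[V Vx fV]; exact: Ck_cont fV Vx.
move=> i; split=> [x /lf[V Vx [_ dV]]|]; first by have [d _] := dV i; exact: d.
by apply: IH => x /lf[V Vx [_ dV]]; have [_ ?] := dV i; exists V.
Qed.

(** Openness matters here: derivatives at a point of [U] see the values of the
    function around that point. *)
Lemma Ck_ext k U f g : open U -> (forall x, U x -> f x = g x) ->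
  Ck k U f -> Ck k U g.
Proof.
move=> oU; elim: k f g => [|k IH] f g fg Cf.
  split => // x Ux; apply: near_eq_continuous (Ck_cont Cf Ux).
  exact: open_near fg.
split => [x Ux|i].
  by apply: near_eq_continuous (Ck_cont Cf Ux); exact: open_near fg.
have [df Cdf] := Cf.2 i; split => [x Ux|].
  by apply: near_eq_derivable (df _ Ux); exact: open_near fg.
apply: IH Cdf => x Ux; apply: near_eq_derive.
exact: open_near fg.
Qed.

Lemma Ck1_differentiable U f x : open U -> Ck 1 U f -> U x ->
  differentiable f x.
Proof.
move=> oU [_ df] Ux; apply: differentiable_partials.
  by apply: open_near oU Ux _ => y Uy i; have [+ _] := df i; exact.
by move=> i; have [_ [cf _]] := df i; exact: cf Ux.
Qed.

Lemma derive_partials f x v : differentiable f x ->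
  'D_v f x = \sum_i v 0 i * 'D_(delta_mx 0 i) f x.
Proof.
move=> df; rewrite deriveE// [in LHS](row_sum_delta v) linear_sum/=.
by apply: eq_bigr => i _; rewrite linearZ/= deriveE.
Qed.

Lemma Ck_cst k U c : Ck k U (fun=> c).
Proof.
elim: k c => [|k IH] c; first by split => // x _; exact: cst_continuous.
split=> [x _|i]; first exact: cst_continuous.
split=> [x _|]; first exact: derivable_cst.
suff -> : 'D_(delta_mx 0 i) (fun _ : 'rV[R]_m => c) = fun=> 0 by exact: IH.
by apply/funext => x; exact: derive_cst.
Qed.

Lemma CkD k U f g : open U -> Ck k U f -> Ck k U g ->
  Ck k U (fun x => f x + g x).
Proof.
move=> oU; elim: k f g => [|k IH] f g Cf Cg.
  by split=> // x Ux; apply: continuousD; [exact: Ck_cont Cf _|exact: Ck_cont Cg _].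
split=> [x Ux|i].
  by apply: continuousD; [exact: Ck_cont Cf _|exact: Ck_cont Cg _].
have [df Cdf] := Cf.2 i; have [dg Cdg] := Cg.2 i; split=> [x Ux|].
  by apply: derivableD; [exact: df|exact: dg].
apply: (Ck_ext oU _ (IH _ _ Cdf Cdg)) => x Ux.
by rewrite deriveD//; [exact: df|exact: dg].
Qed.

Lemma CkM k U f g : open U -> Ck k U f -> Ck k U g ->
  Ck k U (fun x => f x * g x).
Proof.
move=> oU; elim: k f g => [|k IH] f g Cf Cg.
  by split=> // x Ux; apply: continuousM; [exact: Ck_cont Cf _|exact: Ck_cont Cg _].
split=> [x Ux|i].
  by apply: continuousM; [exact: Ck_cont Cf _|exact: Ck_cont Cg _].
have [df Cdf] := Cf.2 i; have [dg Cdg] := Cg.2 i; split=> [x Ux|].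
  by apply: derivableM; [exact: df|exact: dg].
apply: (Ck_ext oU _ (CkD oU (IH _ _ (CkW Cf) Cdg) (IH _ _ (CkW Cg) Cdf))).
by move=> x Ux; rewrite deriveM//; [exact: df|exact: dg].
Qed.

Definition Cinf U f := forall k, Ck k U f.

Lemma Cinf_ext U f g : open U -> (forall x, U x -> f x = g x) ->
  Cinf U f -> Cinf U g.
Proof. by move=> oU fg Cf k; exact: Ck_ext (Cf k). Qed.

Lemma Cinf_sub U V f : U `<=` V -> Cinf V f -> Cinf U f.
Proof. by move=> UV Cf k; exact: Ck_sub (Cf k). Qed.

Lemma Cinf_local U f :
  (forall x, U x -> exists2 V, V x & Cinf V f) -> Cinf U f.
Proof. by move=> lf k; apply: Ck_local => x /lf[V Vx fV]; exists V. Qed.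

Lemma Cinf_cst U c : Cinf U (fun=> c).
Proof. by move=> k; exact: Ck_cst. Qed.

Lemma CinfD U f g : open U -> Cinf U f -> Cinf U g -> Cinf U (fun x => f x + g x).
Proof. by move=> oU Cf Cg k; exact: CkD. Qed.

Lemma CinfM U f g : open U -> Cinf U f -> Cinf U g -> Cinf U (fun x => f x * g x).
Proof. by move=> oU Cf Cg k; exact: CkM. Qed.

Lemma CinfN U f : open U -> Cinf U f -> Cinf U (fun x => - f x).
Proof.
move=> oU Cf; apply: (Cinf_ext oU _ (CinfM oU (Cinf_cst U (-1)) Cf)) => x _.
by rewrite mulN1r.
Qed.

Lemma CinfB U f g : open U -> Cinf U f -> Cinf U g -> Cinf U (fun x => f x - g x).
Proof. by move=> oU Cf Cg; apply: CinfD => //; exact: CinfN. Qed.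

Lemma Cinf_sum (I : Type) (s : seq I) U (f : I -> 'rV[R]_m -> R) :
  open U -> (forall i, Cinf U (f i)) -> Cinf U (fun x => \sum_(i <- s) f i x).
Proof.
move=> oU Cf; elim: s => [|i s IH].
  by apply: (Cinf_ext oU _ (Cinf_cst U 0)) => x _; rewrite big_nil.
by apply: (Cinf_ext oU _ (CinfD oU (Cf i) IH)) => x _; rewrite big_cons.
Qed.

Lemma Cinf_prod (I : Type) (s : seq I) U (f : I -> 'rV[R]_m -> R) :
  open U -> (forall i, Cinf U (f i)) -> Cinf U (fun x => \prod_(i <- s) f i x).
Proof.
move=> oU Cf; elim: s => [|i s IH].
  by apply: (Cinf_ext oU _ (Cinf_cst U 1)) => x _; rewrite big_nil.
by apply: (Cinf_ext oU _ (CinfM oU (Cf i) IH)) => x _; rewrite big_cons.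
Qed.

Lemma Cinf_coord U j : Cinf U (fun x => x 0 j).
Proof.
case=> [|k]; first by split=> // x _; exact: coord_continuous.
split=> [x _|i]; first exact: coord_continuous.
split=> [x _|]; first exact/diff_derivable/differentiable_coord.
suff -> : 'D_(delta_mx 0 i) (fun x : 'rV[R]_m => x 0 j)
    = fun=> (delta_mx 0 i : 'rV[R]_m) 0 j by exact: Ck_cst.
apply/funext => x.
have := @derive_mx R 'rV[R]_m 1 m id x (delta_mx 0 i) (@derivable_id _ _ _ _).
by move=> /matrixP/(_ 0 j); rewrite mxE derive_id => <-.
Qed.

Lemma Cinf_partial U f i : Cinf U f -> Cinf U ('D_(delta_mx 0 i) f).
Proof. by move=> Cf k; have [_ /(_ i)[]] := Cf k.+1. Qed.

Lemma Cinf_differentiable U f x : open U -> Cinf U f -> U x -> differentiable f x.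
Proof. by move=> oU Cf; exact: Ck1_differentiable (Cf 1%N). Qed.

Lemma Cinf_derive_dir U f v : open U -> Cinf U f -> Cinf U ('D_v f).
Proof.
move=> oU Cf; have H i : Cinf U (fun x => v 0 i * 'D_(delta_mx 0 i) f x).
  by apply: CinfM => //; [exact: Cinf_cst|exact: Cinf_partial].
apply: (Cinf_ext oU _ (Cinf_sum (index_enum _) oU H)) => x Ux.
apply/esym/derive_partials; exact: Cinf_differentiable oU Cf Ux.
Qed.

Lemma derive_symmetric U f x v w : open U -> Cinf U f -> U x ->
  'D_w ('D_v f) x = 'D_v ('D_w f) x.
Proof.
move=> oU Cf Ux; have C2 u := Cinf_derive_dir u oU Cf.
have D g y u : Cinf U g -> U y -> derivable g y u.
  by move=> Cg Uy; apply: diff_derivable; exact: Cinf_differentiable oU Cg Uy.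
have C g y : Cinf U g -> U y -> {for y, continuous g}.
  by move=> Cg Uy; exact: Ck_cont (Cg 0%N) Uy.
apply: schwarz.
- apply: open_near oU Ux _ => y Uy.
  by split; apply: D.
- by apply: C => //; exact: Cinf_derive_dir.
- by apply: C => //; exact: Cinf_derive_dir.
Qed.

End CkCalculus.

Definition Cinf_map (R : realType) m p (U : set 'rV[R]_m)
    (phi : 'rV[R]_m -> 'rV[R]_p) := forall j, Cinf U (fun z => phi z 0 j).

Section SmoothMaps.
Variables (R : realType) (m : nat).
Implicit Types (U : set 'rV[R]_m) (f : 'rV[R]_m -> R).

Lemma Cinf_map_differentiable p U (phi : 'rV[R]_m -> 'rV[R]_p) x :
  open U -> Cinf_map U phi -> U x -> differentiable phi x.
Proof.
move=> oU Cphi Ux.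
have -> : phi = \sum_(j < p) (fun z => phi z 0 j *: (delta_mx 0 j : 'rV[R]_p)).
  by apply/funext => z; rewrite [LHS]row_sum_delta fct_sumE.
apply: differentiable_sum => j.
by apply: differentiableZl; exact: Cinf_differentiable oU (Cphi j) Ux.
Qed.

Lemma derive_coord p (phi : 'rV[R]_m -> 'rV[R]_p) x v j :
  differentiable phi x -> ('D_v phi x) 0 j = 'D_v (fun z => phi z 0 j) x.
Proof. by move=> dphi; rewrite derive_mx ?mxE//; exact: diff_derivable. Qed.

Lemma chain_rule p (V : normedModType R) (phi : 'rV[R]_m -> 'rV[R]_p)
    (f : 'rV[R]_p -> V) x v :
  differentiable phi x -> differentiable f (phi x) ->
  'D_v (f \o phi) x = 'D_('D_v phi x) f (phi x).
Proof.
move=> dphi df; rewrite !deriveE//; last exact: differentiable_comp.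
by rewrite diff_comp.
Qed.

(** Induction on the order of differentiability, for all [f] at once: by the
    chain rule the partial derivatives of [f \o phi] are sums of products of
    those of [phi] with functions of the same form, [f] being replaced by its
    partial derivatives. *)
Lemma Cinf_comp p U (V : set 'rV[R]_p) (phi : 'rV[R]_m -> 'rV[R]_p)
    (f : 'rV[R]_p -> R) :
  open U -> open V -> (forall x, U x -> V (phi x)) ->
  Cinf_map U phi -> Cinf V f -> Cinf U (f \o phi).
Proof.
move=> oU oV UV Cphi Cf k.
have dphi x : U x -> differentiable phi x.
  by move=> Ux; exact: Cinf_map_differentiable oU Cphi Ux.
elim: k f Cf => [|k IH] f Cf;
  have dfphi x : U x -> differentiable (f \o phi) x by
    move=> Ux; apply: differentiable_comp; [exact: dphi|
      exact: Cinf_differentiable oV Cf (UV _ Ux)].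
  by split=> // x Ux; apply: differentiable_continuous; exact: dfphi.
split=> [x Ux|i]; first by apply: differentiable_continuous; exact: dfphi.
split=> [x Ux|]; first by apply: diff_derivable; exact: dfphi.
have Ck_term j : Ck k U (fun x => 'D_(delta_mx 0 i) (fun z => phi z 0 j) x
    * ('D_(delta_mx 0 j) f \o phi) x).
  apply: CkM => //; last by apply: IH; exact: Cinf_partial.
  exact: Cinf_partial (Cphi j) k.
have Ck_fsum : Ck k U (fun x => \sum_j 'D_(delta_mx 0 i) (fun z => phi z 0 j) x
    * ('D_(delta_mx 0 j) f \o phi) x).
  elim: (index_enum _) => [|j s IHs].
    by apply: (Ck_ext oU _ (Ck_cst k U 0)) => x _; rewrite big_nil.
  by apply: (Ck_ext oU _ (CkD oU (Ck_term j) IHs)) => x _; rewrite big_cons.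
apply: (Ck_ext oU _ Ck_fsum) => x Ux.
rewrite chain_rule; [|exact: dphi|exact: Cinf_differentiable oV Cf (UV _ Ux)].
rewrite [RHS]derive_partials; last exact: Cinf_differentiable oV Cf (UV _ Ux).
by apply: eq_bigr => j _; rewrite derive_coord//; exact: dphi.
Qed.

Lemma Cinf_map_comp p q U (V : set 'rV[R]_p) (phi : 'rV[R]_m -> 'rV[R]_p)
    (psi : 'rV[R]_p -> 'rV[R]_q) :
  open U -> open V -> (forall x, U x -> V (phi x)) ->
  Cinf_map U phi -> Cinf_map V psi -> Cinf_map U (psi \o phi).
Proof. by move=> oU oV UV Cphi Cpsi j; exact: Cinf_comp oU oV UV Cphi (Cpsi j). Qed.

Lemma Cinf_map_ext p U (phi psi : 'rV[R]_m -> 'rV[R]_p) :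
  open U -> (forall x, U x -> phi x = psi x) ->
  Cinf_map U phi -> Cinf_map U psi.
Proof. by move=> oU e C j; apply: (Cinf_ext oU _ (C j)) => x Ux; rewrite e. Qed.

Lemma Cinf_map_sub p U V (phi : 'rV[R]_m -> 'rV[R]_p) :
  U `<=` V -> Cinf_map V phi -> Cinf_map U phi.
Proof. by move=> UV C j; exact: Cinf_sub UV (C j). Qed.

Lemma Cinf_derive U f (X : 'rV[R]_m -> 'rV[R]_m) :
  open U -> Cinf U f -> Cinf_map U X -> Cinf U (fun z => 'D_(X z) f z).
Proof.
move=> oU Cf CX.
have H i : Cinf U (fun x => X x 0 i * 'D_(delta_mx 0 i) f x).
  by apply: CinfM => //; exact: Cinf_partial.
apply: (Cinf_ext oU _ (Cinf_sum (index_enum _) oU H)) => x Ux.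
apply/esym/derive_partials; exact: Cinf_differentiable oU Cf Ux.
Qed.

Lemma Cinf_map_derive p U (phi : 'rV[R]_m -> 'rV[R]_p) X :
  open U -> Cinf_map U phi -> Cinf_map U X ->
  Cinf_map U (fun z => 'D_(X z) phi z).
Proof.
move=> oU Cphi CX j; apply: (Cinf_ext oU _ (Cinf_derive oU (Cphi j) CX)) => x Ux.
by rewrite derive_coord//; exact: Cinf_map_differentiable oU Cphi Ux.
Qed.

Lemma derive_linear_dir (V : normedModType R) (f : 'rV[R]_m -> V) x a v w :
  differentiable f x -> 'D_(a *: v + w) f x = a *: 'D_v f x + 'D_w f x.
Proof. by move=> d; rewrite !deriveE// linearP. Qed.

Lemma deriveB_dir f x v w : differentiable f x ->
  'D_(v - w) f x = 'D_v f x - 'D_w f x.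
Proof. by move=> d; rewrite !deriveE// linearB. Qed.

(** Leibniz rule for the pairing of the differential of [f] with a moving
    direction [X]. *)
Lemma derive_derive U f X x w : open U -> Cinf U f -> Cinf_map U X -> U x ->
  'D_w (fun z => 'D_(X z) f z) x = 'D_w ('D_(X x) f) x + 'D_('D_w X x) f x.
Proof.
move=> oU Cf CX Ux.
have df z : U z -> differentiable f z by exact: Cinf_differentiable oU Cf.
have dX : differentiable X x by exact: Cinf_map_differentiable oU CX Ux.
have dC g : Cinf U g -> derivable g x w.
  by move=> Cg; apply: diff_derivable; exact: Cinf_differentiable oU Cg Ux.
have E (Y : 'rV[R]_m -> 'rV[R]_m) : Cinf_map U Y ->
    'D_w (fun z => 'D_(Y z) f z) x =
    \sum_i (Y x 0 i * 'D_w ('D_(delta_mx 0 i) f) x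
            + 'D_(delta_mx 0 i) f x * 'D_w (fun z => Y z 0 i) x).
  move=> CY; rewrite (@near_eq_derive _ _ _ _
    (\sum_(i < m) (fun z => Y z 0 i * 'D_(delta_mx 0 i) f z))); last first.
    apply: open_near oU Ux _ => z Uz.
    by rewrite derive_partials ?fct_sumE//; exact: df.
  rewrite derive_sum => [|i]; last first.
    by apply: derivableM; apply: dC => //; exact: Cinf_partial.
  apply: eq_bigr => i _; rewrite deriveM//; apply: dC => //.
  exact: Cinf_partial.
rewrite E// (E (fun=> X x)); last by move=> j; exact: Cinf_cst.
rewrite (derive_partials ('D_w X x)); last exact: df.
rewrite -big_split/=; apply: eq_bigr => i _.
rewrite derive_cst mulr0 addr0 derive_coord//; congr (_ + _); exact: mulrC.
Qed.

(** The second derivatives of [f] cancel by symmetry, and only the derivatives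
    of the directions [X] and [Y] remain.  This one identity gives both the
    invariance of the Lie bracket under changes of charts and its action on
    functions. *)
Lemma derive_commutator U f X Y x :
  open U -> Cinf U f -> Cinf_map U X -> Cinf_map U Y -> U x ->
  'D_(X x) (fun z => 'D_(Y z) f z) x - 'D_(Y x) (fun z => 'D_(X z) f z) x
  = 'D_('D_(X x) Y x - 'D_(Y x) X x) f x.
Proof.
move=> oU Cf CX CY Ux.
have EY := derive_derive (X x) oU Cf CY Ux.
have EX := derive_derive (Y x) oU Cf CX Ux.
have S := derive_symmetric (X x) (Y x) oU Cf Ux.
have df := Cinf_differentiable oU Cf Ux.
have L := deriveB_dir ('D_(X x) Y x) ('D_(Y x) X x) df.
apply: etrans (congr2 (fun a b => a - b) EY EX) (etrans _ (esym L)).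
by rewrite S opprD addrACA subrr add0r.
Qed.

End SmoothMaps.

(** * Bump functions in coordinate spaces *)

Section Flat.
Variable R : realType.

(** The factors [s^-j] make the family stable under derivation, so that the
    smoothness of all its members is proved by a single induction. *)
Definition flat_exp (j : nat) (s : R) : R :=
  if 0 < s then s^-1 ^+ j * expR (- s^-1) else 0.

Lemma flat_exp_le0 j s : s <= 0 -> flat_exp j s = 0.
Proof. by rewrite /flat_exp leNgt => /negbTE ->. Qed.

Lemma flat_exp_ge0 j s : 0 <= flat_exp j s.
Proof.
by rewrite /flat_exp; case: ifP => // s0; rewrite mulr_ge0 ?expR_ge0// exprn_ge0// invr_ge0 ltW.
Qed.

Lemma flat_exp_gt0 j s : 0 < s -> 0 < flat_exp j s.
Proof. by rewrite /flat_exp => s0; rewrite s0 mulr_gt0 ?expR_gt0// exprn_gt0// invr_gt0. Qed.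

(** From [expR t >= t ^+ j.+2 / (j.+2)`!] at [t = s^-1].  The quadratic bound
    makes the derivative at the origin vanish. *)
Lemma flat_exp_le j s : `|flat_exp j s| <= (j.+2)`!%:R * s ^+ 2.
Proof.
rewrite ger0_norm ?flat_exp_ge0//.
have [s0|s0] := leP s 0; first by rewrite flat_exp_le0// mulr_ge0// sqr_ge0.
rewrite /flat_exp s0 expRN ler_pdivrMr ?expR_gt0//.
have t0 : 0 <= s^-1 by rewrite invr_ge0 ltW.
have H : s^-1 ^+ j.+2 <= (j.+2)`!%:R * expR s^-1.
  rewrite mulrC -ler_pdivrMr ?ltr0n ?fact_gt0//.
  by apply: le_trans (expR_ge1Dxn j.+1 t0); rewrite lerDr.
have -> : s^-1 ^+ j = s ^+ 2 * s^-1 ^+ j.+2.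
  by rewrite -[j.+2]addn2 exprD mulrCA -exprMn divff ?gt_eqF// expr1n mulr1.
by rewrite [leRHS]mulrAC [leRHS]mulrC ler_wpM2l// sqr_ge0.
Qed.

Lemma is_derive_flat_exp j s :
  is_derive s (1 : R) (flat_exp j) (flat_exp j.+2 s - j%:R * flat_exp j.+1 s).
Proof.
have [s0|s0|s0] := ltgtP s 0.
- rewrite !flat_exp_le0 ?ltW// mulr0 subrr.
  apply: (@near_eq_is_derive _ _ _ (cst (0:R))).
  near=> y; rewrite flat_exp_le0//; apply: ltW; near: y.
  exact: lt_nbhsl.
- rewrite /flat_exp s0.
  have sn0 : s != 0 by rewrite gt_eqF.
  have dV : is_derive s (1 : R) (fun y : R => y^-1) (- s ^- 2 *: (1 : R)).
    exact: is_deriveV sn0 (is_derive_id s (1 : R)).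
  have dE : is_derive s (1 : R) (fun y : R => expR (- y^-1))
      (expR (- s^-1) * - (- s ^- 2 *: (1 : R))).
    exact: (@is_derive1_comp R expR (- (fun y : R => y^-1)) s _ _
      (is_derive_expR (- s^-1)) (is_deriveN dV)).
  have := is_deriveM (is_deriveX j dV) dE => dXE.
  apply: (@near_eq_is_derive _ _ _ ((fun y : R => y^-1) ^+ j * (fun y : R => expR (- y^-1)))).
    near=> y; rewrite ifT; first by rewrite !fctE.
    by near: y; exact: lt_nbhsr.
  apply: is_derive_eq dXE _.
  have -> : ((fun y : R => y^-1) ^+ j) s = s^-1 ^+ j by rewrite fctE.
  rewrite -!exprVn; move: s^-1 (expR _) => t E.
  rewrite /GRing.scale/=; case: j => [|k]; first by rewrite !expr0; ring.
  by rewrite !exprS; ring.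
- rewrite s0 !flat_exp_le0// mulr0 subrr.
  suff H : h^-1 *: (flat_exp j (h *: (1:R) + 0) - flat_exp j 0) @[h --> 0^'] --> (0 : R).
    apply: DeriveDef; last exact/cvg_lim.
    by apply/cvg_ex; exists 0.
  apply/cvgr0Pnorm_le => e e0; near=> h.
  have h0 : h != 0 by near: h; exact: nbhs_dnbhs_neq.
  rewrite (flat_exp_le0 j (lexx 0)) subr0 addr0 [h *: _]mulr1 normrZ normfV.
  rewrite ler_pdivrMl ?normr_gt0//.
  apply: le_trans (flat_exp_le _ _) _; rewrite -real_normK ?num_real// expr2.
  rewrite mulrA [leRHS]mulrC ler_wpM2r// -ler_pdivlMl ?ltr0n ?fact_gt0//.
  by near: h; apply: dnbhs0_le; rewrite mulr_gt0// invr_gt0 ltr0n fact_gt0.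
Unshelve. all: by end_near. Qed.

Lemma derive_comp1 m (F : R -> R) dF (g : 'rV[R]_m -> R) x v :
  is_derive (g x) (1 : R) F dF -> differentiable g x ->
  differentiable (F \o g) x /\ 'D_v (F \o g) x = dF * 'D_v g x.
Proof.
move=> HF dg; have dFg : derivable F (g x) 1 by exact: ex_derive.
have dF1 : differentiable F (g x) by apply/derivable1_diffP.
have dFog : differentiable (F \o g) x by exact: differentiable_comp.
split=> //; rewrite !deriveE// diff_comp//= deriv1E// derive1E derive_val.
exact: mulrC.
Qed.

(** The derivative of a member of the family composed with [g] is a combination
    of two other members composed with [g], times a derivative of [g]. *)
Lemma Cinf_flat_exp m (U : set 'rV[R]_m) (g : 'rV[R]_m -> R) j :
  open U -> Cinf U g -> Cinf U (flat_exp j \o g).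
Proof.
move=> oU Cg k.
have dg x : U x -> differentiable g x by exact: Cinf_differentiable oU Cg.
elim: k j => [|k IH] j.
  split=> // x Ux; apply: differentiable_continuous.
  exact: (derive_comp1 0 (is_derive_flat_exp j _) (dg _ Ux)).1.
have D x v (Ux : U x) := derive_comp1 v (is_derive_flat_exp j _) (dg _ Ux).
split=> [x Ux|i]; first by apply: differentiable_continuous; exact: (D x 0 Ux).1.
split=> [x Ux|]; first by apply: diff_derivable; exact: (D x 0 Ux).1.
have Cdg : Ck k U ('D_(delta_mx 0 i) g) by exact: Cinf_partial Cg k.
have C1 : Ck k U (fun x => - j%:R * (flat_exp j.+1 \o g) x).
  by apply: CkM => //; exact: Ck_cst.
apply: (Ck_ext oU _ (CkM oU (CkD oU (IH j.+2) C1) Cdg)) => x Ux.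
by rewrite (D x _ Ux).2 mulNr.
Qed.

End Flat.

Section Bump.
Variables (R : realType) (m : nat).

(** A product over the coordinates: its support is a ball for the maximum
    norm. *)
Definition cutoff (z0 : 'rV[R]_m) (r : R) (z : 'rV[R]_m) : R :=
  \prod_(j < m) (flat_exp 0 (1 - ((z 0 j - z0 0 j) / r) ^+ 2) / flat_exp 0 1).

Lemma cutoff_center z0 r : cutoff z0 r z0 = 1.
Proof.
rewrite /cutoff big1// => j _.
by rewrite subrr mul0r expr0n subr0 divff// gt_eqF// flat_exp_gt0.
Qed.

Lemma Cinf_cutoff z0 r U : open U -> Cinf U (cutoff z0 r).
Proof.
move=> oU; apply: Cinf_prod => // j.
apply: CinfM => //; last exact: Cinf_cst.
apply: (@Cinf_flat_exp _ _ U (fun z => 1 - ((z 0 j - z0 0 j) / r) ^+ 2)) => //.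
have C1 : Cinf U (fun z => (z 0 j - z0 0 j) / r).
  apply: CinfM => //; last exact: Cinf_cst.
  by apply: CinfB => //; [exact: Cinf_coord|exact: Cinf_cst].
by apply: CinfB => //; [exact: Cinf_cst|exact: CinfM].
Qed.

Lemma cutoff_eq0 z0 r z : 0 < r -> r < `|z - z0| -> cutoff z0 r z = 0.
Proof.
move=> r0 rz; have [/existsP[j rj]|/existsPn H] :=
    boolP [exists j, r <= `|(z - z0) 0 j|]; last first.
  suff : `|z - z0| <= r by rewrite leNgt rz.
  by apply: rV_norm_le (ltW r0) _ => j; rewrite ltW// ltNge H.
rewrite /cutoff (bigD1 j)//= flat_exp_le0 ?mul0r// subr_le0.
rewrite -real_normK ?num_real// normrM normfV (gtr0_norm r0).
by rewrite expr_ge1// ?mulr_ge0// ?invr_ge0 ?(ltW r0)// ler_pdivlMr// mul1r !mxE in rj *.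
Qed.

End Bump.

(** * Vector fields on a manifold given by an atlas *)

Lemma cinv_cmap (R : realType) (T : choiceType) m (c : chart R T m) p q :
  (forall q', cdom c q' -> cmap c q' = cmap c q -> q' = q) ->
  cdom c q -> cinv c p (cmap c q) = q.
Proof.
move=> inj cq.
have [|cq' e] := @xgetPex _ p [set q' | cdom c q' /\ cmap c q' = cmap c q].
  by exists q.
exact: inj.
Qed.

(** What the calculus of vector fields needs of a manifold.  No topology on the
    carrier [T] is mentioned, openness being required of the images under the
    charts only; the same statements thus apply to a manifold and to its slit
    tangent bundle. *)
Record coord_atlas (R : realType) (T : choiceType) (m : nat)
    (A : atlas R T m) : Prop := {
  ca_chart_at : forall p, charts A (chart_at A p) ;
  ca_cdom_at : forall p, cdom (chart_at A p) p ;
  ca_inj : forall c q q', charts A c -> cdom c q -> cdom c q' ->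
    cmap c q = cmap c q' -> q = q' ;
  ca_open : forall c c', charts A c -> charts A c' ->
    open (cmap c @` (cdom c `&` cdom c')) ;
  ca_transition : forall c c' p, charts A c -> charts A c' ->
    Cinf_map (cmap c @` (cdom c `&` cdom c')) (transition c c' p) }.

Section CoordAtlas.
Variables (R : realType) (T : choiceType) (m : nat) (A : atlas R T m).
Hypothesis hA : coord_atlas A.
Implicit Types (c : chart R T m) (p q : T) (X Y Z : vfield R T m) (f g : T -> R).

Let in_chart_at := ca_cdom_at hA.
Let chart_atP := ca_chart_at hA.

Definition overlap c c' : set 'rV[R]_m := cmap c @` (cdom c `&` cdom c').

Lemma open_img c : charts A c -> open (cmap c @` cdom c).
Proof. by move=> Ac; have := ca_open hA Ac Ac; rewrite setIid. Qed.

Lemma cinvK c p q : charts A c -> cdom c q -> cinv c p (cmap c q) = q.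
Proof.
by move=> Ac cq; apply: cinv_cmap => // q' cq'; exact: (ca_inj hA).
Qed.

Lemma transitionE c c' p q : charts A c -> cdom c q ->
  transition c c' p (cmap c q) = cmap c' q.
Proof. by move=> Ac cq; rewrite /transition cinvK. Qed.

Lemma overlapE c c' q : cdom c q -> cdom c' q -> overlap c c' (cmap c q).
Proof. by move=> cq c'q; exists q. Qed.

Lemma transition_differentiable c c' p q : charts A c -> charts A c' ->
  cdom c q -> cdom c' q -> differentiable (transition c c' p) (cmap c q).
Proof.
move=> Ac Ac' cq c'q; apply: (Cinf_map_differentiable (ca_open hA Ac Ac')).
  exact: (ca_transition hA).
exact: overlapE.
Qed.

Lemma near_overlap c c' q (P : 'rV[R]_m -> Prop) :
  charts A c -> charts A c' -> cdom c q -> cdom c' q ->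
  (forall q', cdom c q' -> cdom c' q' -> P (cmap c q')) ->
  \forall z \near cmap c q, P z.
Proof.
move=> Ac Ac' cq c'q H; apply: open_near (ca_open hA Ac Ac') _ _.
  exact: overlapE.
by move=> _ [q' [? ?] <-]; exact: H.
Qed.

Lemma derive_transition_comp c c' c'' p p' p'' q v :
  charts A c -> charts A c' -> charts A c'' ->
  cdom c q -> cdom c' q -> cdom c'' q ->
  'D_v (transition c c'' p) (cmap c q) =
  'D_('D_v (transition c c' p') (cmap c q)) (transition c' c'' p'') (cmap c' q).
Proof.
move=> Ac Ac' Ac'' cq c'q c''q.
have dcc' : differentiable (transition c c' p') (cmap c q).
  exact: transition_differentiable.
have tq := @transitionE c c' p' q Ac cq.
have dc'c'' : differentiable (transition c' c'' p'') (transition c c' p' (cmap c q)).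
  by rewrite tq; exact: transition_differentiable.
apply: etrans (etrans (chain_rule v dcc' dc'c'') _); last by rewrite tq.
apply: near_eq_derive.
apply: (near_overlap Ac Ac' cq c'q) => q' cq' c'q'.
by rewrite /= !transitionE.
Qed.

Lemma derive_transition_id c p q v : charts A c -> cdom c q ->
  'D_v (transition c c p) (cmap c q) = v.
Proof.
move=> Ac cq; rewrite (@near_eq_derive _ _ _ _ id) ?derive_id//.
by apply: (near_overlap Ac Ac cq cq) => q' cq' _; rewrite transitionE.
Qed.

(** Tangent vectors are stored by their coordinates in the preferred chart of
    their base point; the chain rule makes the passage to the other charts
    consistent, so that the preferred chart can be forgotten. *)
Lemma to_chart_change c c' p q v : charts A c -> charts A c' ->
  cdom c q -> cdom c' q ->
  to_chart A c' q v = 'D_(to_chart A c q v) (transition c c' p) (cmap c q).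
Proof. by move=> *; exact: derive_transition_comp. Qed.

Lemma to_chart_at q v : to_chart A (chart_at A q) q v = v.
Proof. exact: derive_transition_id. Qed.

Lemma of_chartK c q w : charts A c -> cdom c q ->
  to_chart A c q (of_chart A c q w) = w.
Proof.
move=> Ac cq; rewrite /to_chart /of_chart.
rewrite -(@derive_transition_comp c (chart_at A q) c q)//.
exact: derive_transition_id.
Qed.

Lemma to_chartK c q v : charts A c -> cdom c q ->
  of_chart A c q (to_chart A c q v) = v.
Proof.
move=> Ac cq; rewrite /to_chart /of_chart.
rewrite -(@derive_transition_comp (chart_at A q) c (chart_at A q) q)//.
exact: derive_transition_id.
Qed.

Lemma to_chart_linear c q a v w : charts A c -> cdom c q ->
  to_chart A c q (a *: v + w) = a *: to_chart A c q v + to_chart A c q w.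
Proof.
by move=> Ac cq; apply: derive_linear_dir; exact: transition_differentiable.
Qed.

Opaque to_chart of_chart.

Lemma to_chartD c q v w : charts A c -> cdom c q ->
  to_chart A c q (v + w) = to_chart A c q v + to_chart A c q w.
Proof. by move=> Ac cq; have := to_chart_linear 1 v w Ac cq; rewrite !scale1r. Qed.

Lemma to_chart0 c q : charts A c -> cdom c q -> to_chart A c q 0 = 0.
Proof.
by move=> Ac cq; apply: (addrI (to_chart A c q 0)); rewrite -to_chartD// !addr0.
Qed.

Lemma to_chartZ c q a v : charts A c -> cdom c q ->
  to_chart A c q (a *: v) = a *: to_chart A c q v.
Proof. by move=> Ac cq; have := to_chart_linear a v 0 Ac cq; rewrite to_chart0// !addr0. Qed.

Lemma vf_repE c p X q : charts A c -> cdom c q ->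
  vf_rep A c p X (cmap c q) = to_chart A c q (X q).
Proof. by move=> Ac cq; rewrite /vf_rep cinvK. Qed.

Lemma smooth_vfP X : smooth_vf A X <->
  forall c p, charts A c -> Cinf_map (cmap c @` cdom c) (vf_rep A c p X).
Proof.
split=> [sX c p Ac j k|sX c p j k Ac]; first exact: sX.
exact: sX.
Qed.

(** Smoothness of a field only has to be checked on a convenient formula [G]
    for its components in each chart. *)
Lemma smooth_vf_ext X (G : chart R T m -> T -> 'rV[R]_m -> 'rV[R]_m) :
  (forall c p, charts A c -> Cinf_map (cmap c @` cdom c) (G c p)) ->
  (forall c p q, charts A c -> cdom c q ->
     to_chart A c q (X q) = G c p (cmap c q)) ->
  smooth_vf A X.
Proof.
move=> sG XG; apply/smooth_vfP => c p Ac.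
apply: (Cinf_map_ext (open_img Ac) _ (sG c p Ac)) => _ [q cq <-].
by rewrite vf_repE// -XG.
Qed.

Lemma smooth_fun_ext f (G : chart R T m -> T -> 'rV[R]_m -> R) :
  (forall c p, charts A c -> Cinf (cmap c @` cdom c) (G c p)) ->
  (forall c p q, charts A c -> cdom c q -> f q = G c p (cmap c q)) ->
  smooth_fun A f.
Proof.
move=> sG fG k c p Ac.
apply: (Ck_ext (open_img Ac) _ (sG c p Ac k)) => _ [q cq <-].
by rewrite /= cinvK// -fG.
Qed.

Lemma smooth_funP f c p : smooth_fun A f -> charts A c ->
  Cinf (cmap c @` cdom c) (f \o cinv c p).
Proof. by move=> sf Ac k; exact: sf. Qed.

Lemma in_img c q : cdom c q -> (cmap c @` cdom c) (cmap c q).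
Proof. by move=> cq; exists q. Qed.

Lemma vf_rep_differentiable X c p q : smooth_vf A X -> charts A c -> cdom c q ->
  differentiable (vf_rep A c p X) (cmap c q).
Proof.
move=> /smooth_vfP sX Ac cq.
by apply: (Cinf_map_differentiable (open_img Ac) (sX _ _ Ac)); exact: in_img.
Qed.

Lemma fun_rep_differentiable f c p q : smooth_fun A f -> charts A c -> cdom c q ->
  differentiable (f \o cinv c p) (cmap c q).
Proof.
move=> sf Ac cq.
by apply: (Cinf_differentiable (open_img Ac) (smooth_funP _ sf Ac)); exact: in_img.
Qed.

Lemma vf_act_chart X f c p q : smooth_fun A f -> charts A c -> cdom c q ->
  vf_act A X f q = 'D_(to_chart A c q (X q)) (f \o cinv c p) (cmap c q).
Proof.
move=> sf Ac cq; rewrite /vf_act.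
have Ac0 := chart_atP q; have c0q := in_chart_at q.
rewrite (to_chart_change q _ Ac0 Ac c0q cq) to_chart_at.
rewrite -[in RHS](@transitionE (chart_at A q) c q q)// -chain_rule.
- apply: near_eq_derive; apply: (near_overlap Ac0 Ac c0q cq) => q' c0q' cq'.
  by rewrite /= transitionE// !cinvK.
- exact: transition_differentiable.
- by rewrite transitionE//; exact: fun_rep_differentiable.
Qed.

Lemma smooth_vf_act X f : smooth_vf A X -> smooth_fun A f -> smooth_fun A (vf_act A X f).
Proof.
move=> sX sf; apply: (@smooth_fun_ext _ (fun c p z =>
  'D_(vf_rep A c p X z) (f \o cinv c p) z)) => c p.
  move=> Ac; apply: Cinf_derive (open_img Ac) (smooth_funP _ sf Ac) _.
  exact: (smooth_vfP X).1 sX c p Ac.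
by move=> q Ac cq; rewrite vf_repE// (@vf_act_chart _ _ c p).
Qed.

(** Let [phi] be the change of charts from the preferred chart at [q] to [c].
    The components of a field in [c], composed with [phi], are the derivatives
    of the components of [phi] along that field, so the right-hand side is a
    commutator of two derivations applied to the components of [phi]. *)
Lemma bracket_chart X Y c p q : smooth_vf A X -> smooth_vf A Y ->
  charts A c -> cdom c q ->
  to_chart A c q (bracket A X Y q) =
  'D_(to_chart A c q (X q)) (vf_rep A c p Y) (cmap c q)
  - 'D_(to_chart A c q (Y q)) (vf_rep A c p X) (cmap c q).
Proof.
move=> sX sY Ac cq.
have Ac0 := chart_atP q; have c0q := in_chart_at q.
set c0 := chart_at A q in Ac0 c0q *.
pose phi := transition c0 c q; pose z0 := cmap c0 q.
have dphi : differentiable phi z0 by exact: transition_differentiable.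
have phiz0 : phi z0 = cmap c q by rewrite /phi /z0 transitionE.
pose O := overlap c0 c.
have oO : open O by exact: (ca_open hA).
have Oz0 : O z0 by exact: overlapE.
have sphi : Cinf_map O phi by exact: (ca_transition hA).
pose X0 := vf_rep A c0 q X; pose Y0 := vf_rep A c0 q Y.
have sub : O `<=` cmap c0 @` cdom c0 by move=> _ [q' [? _] <-]; exists q'.
have sX0 : Cinf_map O X0 by exact: Cinf_map_sub sub ((smooth_vfP X).1 sX c0 q Ac0).
have sY0 : Cinf_map O Y0 by exact: Cinf_map_sub sub ((smooth_vfP Y).1 sY c0 q Ac0).
have push W z : O z -> vf_rep A c p W (phi z) = 'D_(vf_rep A c0 q W z) phi z.
  move=> [q' [c0q' cq'] <-].
  rewrite /phi (transitionE _ _ Ac0 c0q') (vf_repE _ _ Ac cq') (vf_repE _ _ Ac0 c0q').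
  exact: to_chart_change.
have second W W' j : smooth_vf A W' ->
    ('D_(to_chart A c q (W q)) (vf_rep A c p W') (cmap c q)) 0 j =
    'D_(vf_rep A c0 q W z0) (fun z => 'D_(vf_rep A c0 q W' z) (fun y => phi y 0 j) z) z0.
  move=> sW'; have dW' : differentiable (vf_rep A c p W') (phi z0).
    by rewrite phiz0; exact: vf_rep_differentiable.
  rewrite -(vf_repE p W Ac cq) -phiz0 (push W _ Oz0).
  rewrite -(chain_rule _ dphi dW') derive_coord; last exact: differentiable_comp.
  apply: near_eq_derive; apply: (open_near oO Oz0) => z Oz.
  rewrite /= push// derive_coord//.
  exact: Cinf_map_differentiable oO sphi Oz.
apply/rowP => j; rewrite [RHS]mxE [X in _ + X]mxE.
apply: etrans (esym (congr2 (fun a b => a - b) (second X Y j sY) (second Y X j sX))).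
rewrite (derive_commutator oO (sphi j) sX0 sY0 Oz0).
rewrite (to_chart_change q _ Ac0 Ac c0q cq) /c0 to_chart_at (derive_coord _ _ dphi).
have X0q : X0 z0 = X q.
  by rewrite /X0 /z0 (vf_repE _ X Ac0 c0q) /c0 to_chart_at.
have Y0q : Y0 z0 = Y q.
  by rewrite /Y0 /z0 (vf_repE _ Y Ac0 c0q) /c0 to_chart_at.
by rewrite X0q Y0q.
Qed.

End CoordAtlas.

Lemma bracketE (R : realType) (T : choiceType) m (A : atlas R T m)
    (X Y : vfield R T m) q : bracket A X Y q =
  'D_(X q) (vf_rep A (chart_at A q) q Y) (cmap (chart_at A q) q)
  - 'D_(Y q) (vf_rep A (chart_at A q) q X) (cmap (chart_at A q) q).
Proof. by []. Qed.

Lemma vf_actE (R : realType) (T : choiceType) m (A : atlas R T m)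
    (X : vfield R T m) (f : T -> R) q : vf_act A X f q =
  'D_(X q) (f \o cinv (chart_at A q) q) (cmap (chart_at A q) q).
Proof. by []. Qed.

Opaque vf_rep bracket vf_act.

Lemma addfE (T : Type) (V : zmodType) (f g : T -> V) q : (f + g) q = f q + g q.
Proof. by []. Qed.

Lemma oppfE (T : Type) (V : zmodType) (f : T -> V) q : (- f) q = - f q.
Proof. by []. Qed.

Lemma subfE (T : Type) (V : zmodType) (f g : T -> V) q : (f - g) q = f q - g q.
Proof. by []. Qed.

Lemma rV_combE (R : pzRingType) m (a b : R) (u v : 'rV[R]_m) j :
  (a *: u + b *: v) 0 j = a * u 0 j + b * v 0 j.
Proof. by rewrite !mxE. Qed.

Lemma rV_subE (R : pzRingType) m (u v : 'rV[R]_m) j :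
  (u - v) 0 j = u 0 j - v 0 j.
Proof. by rewrite !mxE. Qed.

Section Fields.
Variables (R : realType) (T : choiceType) (m : nat) (A : atlas R T m).
Hypothesis hA : coord_atlas A.
Implicit Types (c : chart R T m) (p q : T) (X Y Z : vfield R T m) (f g : T -> R).

Let in_chart_at := ca_cdom_at hA.
Let chart_atP := ca_chart_at hA.

Lemma smooth_vfD X Y : smooth_vf A X -> smooth_vf A Y -> smooth_vf A (X + Y).
Proof.
move=> sX sY; apply: (smooth_vf_ext hA (G := fun c p z => vf_rep A c p X z + vf_rep A c p Y z)).
  move=> c p Ac j.
  apply: (Cinf_ext (open_img hA Ac) _ (CinfD (open_img hA Ac)
    ((smooth_vfP A X).1 sX c p Ac j) ((smooth_vfP A Y).1 sY c p Ac j))) => z _.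
  by rewrite mxE.
by move=> c p q Ac cq; rewrite !(vf_repE hA)// -(to_chartD hA).
Qed.

Lemma smooth_fscale f X : smooth_fun A f -> smooth_vf A X -> smooth_vf A (fscale f X).
Proof.
move=> sf sX; apply: (smooth_vf_ext hA (G := fun c p z => (f \o cinv c p) z *: vf_rep A c p X z)).
  move=> c p Ac j.
  apply: (Cinf_ext (open_img hA Ac) _ (CinfM (open_img hA Ac)
    (smooth_funP p sf Ac) ((smooth_vfP A X).1 sX c p Ac j))) => z _.
  by rewrite mxE.
by move=> c p q Ac cq; rewrite (vf_repE hA)// /= (cinvK hA)// -(to_chartZ hA).
Qed.

Lemma smooth_fun_cst (a : R) : smooth_fun A (fun=> a).
Proof. by move=> k c p Ac; exact: Ck_cst. Qed.

Lemma smooth_vfZ a X : smooth_vf A X -> smooth_vf A (a *: X).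
Proof. by move=> sX; apply: (smooth_fscale (smooth_fun_cst a) sX). Qed.

Lemma smooth_vfN X : smooth_vf A X -> smooth_vf A (- X).
Proof. by rewrite -scaleN1r; exact: smooth_vfZ. Qed.

Lemma smooth_vfB X Y : smooth_vf A X -> smooth_vf A Y -> smooth_vf A (X - Y).
Proof. by move=> sX sY; exact: (smooth_vfD sX (smooth_vfN sY)). Qed.

Lemma smooth_funB f g : smooth_fun A f -> smooth_fun A g -> smooth_fun A (f - g).
Proof.
move=> sf sg k c p Ac.
exact: (CinfB (open_img hA Ac) (smooth_funP p sf Ac) (smooth_funP p sg Ac)).
Qed.

Lemma smooth_bracket X Y : smooth_vf A X -> smooth_vf A Y -> smooth_vf A (bracket A X Y).
Proof.
move=> sX sY; apply: (smooth_vf_ext hA (G := fun c p z =>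
   'D_(vf_rep A c p X z) (vf_rep A c p Y) z - 'D_(vf_rep A c p Y z) (vf_rep A c p X) z)).
  move=> c p Ac j; have oI := open_img hA Ac.
  have CX := (smooth_vfP A X).1 sX c p Ac; have CY := (smooth_vfP A Y).1 sY c p Ac.
  apply: (Cinf_ext oI _ (CinfB oI (Cinf_map_derive oI CY CX j) (Cinf_map_derive oI CX CY j))).
  by move=> z _; rewrite rV_subE.
move=> c p q Ac cq.
by rewrite (bracket_chart hA p sX sY Ac cq) (vf_repE hA p X Ac cq) (vf_repE hA p Y Ac cq).
Qed.

Lemma bracketC X Y : bracket A X Y = - bracket A Y X.
Proof. by apply/funext => q; rewrite oppfE !bracketE opprB. Qed.

Lemma vf_actDl X Y f : smooth_fun A f ->
  vf_act A (X + Y) f = vf_act A X f + vf_act A Y f.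
Proof.
move=> sf; apply/funext => q; rewrite addfE !vf_actE.
have d := fun_rep_differentiable hA q sf (chart_atP q) (in_chart_at q).
have := derive_linear_dir 1 (X q) (Y q) d.
by rewrite !scale1r.
Qed.

Lemma vf_act0l f : vf_act A 0 f = 0.
Proof. by apply/funext => q; rewrite vf_actE; exact: derive0. Qed.

Lemma vf_actNl X f : smooth_fun A f -> vf_act A (- X) f = - vf_act A X f.
Proof.
by move=> sf; apply/eqP; rewrite -addr_eq0 -(vf_actDl (- X) X sf) addNr vf_act0l.
Qed.

Lemma vf_actDr X f g : smooth_fun A f -> smooth_fun A g ->
  vf_act A X (f + g) = vf_act A X f + vf_act A X g.
Proof.
move=> sf sg; apply/funext => q; rewrite addfE !vf_actE.
have df := fun_rep_differentiable hA q sf (chart_atP q) (in_chart_at q).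
have dg := fun_rep_differentiable hA q sg (chart_atP q) (in_chart_at q).
exact: (deriveD (diff_derivable df) (diff_derivable dg)).
Qed.

Lemma vf_act0 X : vf_act A X 0 = 0.
Proof. by apply/funext => q; rewrite vf_actE; exact: derive_cst. Qed.

Lemma bracketDl X Y Z : smooth_vf A X -> smooth_vf A Y -> smooth_vf A Z ->
  bracket A (X + Y) Z = bracket A X Z + bracket A Y Z.
Proof.
move=> sX sY sZ; apply/funext => q; rewrite addfE !bracketE.
have Ac := chart_atP q; have cq := in_chart_at q.
move: (chart_at A q) Ac cq => c Ac cq.
have dX := vf_rep_differentiable hA q sX Ac cq.
have dY := vf_rep_differentiable hA q sY Ac cq.
have dZ := vf_rep_differentiable hA q sZ Ac cq.
have E1 : 'D_(Z q) (vf_rep A c q (X + Y)) (cmap c q)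
  = 'D_(Z q) (vf_rep A c q X) (cmap c q) + 'D_(Z q) (vf_rep A c q Y) (cmap c q).
  rewrite -(deriveD (diff_derivable dX) (diff_derivable dY)).
  apply: near_eq_derive; apply: (near_overlap hA Ac Ac cq cq) => q' cq' _.
  by rewrite addfE !(vf_repE hA)// -(to_chartD hA).
have E2 := derive_linear_dir 1 (X q) (Y q) dZ; rewrite !scale1r in E2.
have -> : (X + Y) q = X q + Y q by [].
by apply: etrans (congr2 (fun a b => a - b) E2 E1) _; rewrite opprD addrACA.
Qed.

Lemma bracketDr X Y Z : smooth_vf A X -> smooth_vf A Y -> smooth_vf A Z ->
  bracket A X (Y + Z) = bracket A X Y + bracket A X Z.
Proof.
move=> sX sY sZ; rewrite (bracketC X (Y + Z)) (bracketDl sY sZ sX) opprD.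
by rewrite (bracketC X Y) (bracketC X Z).
Qed.

(** The bracket is not linear over functions; the extra term is a multiple of
    [X], so it is killed by every operator that kills [X]. *)
Lemma bracket_fscalel f X Z : smooth_fun A f -> smooth_vf A X -> smooth_vf A Z ->
  bracket A (fscale f X) Z = fscale f (bracket A X Z) - fscale (vf_act A Z f) X.
Proof.
move=> sf sX sZ; apply/funext => q; rewrite subfE /fscale !bracketE vf_actE.
have Ac := chart_atP q; have cq := in_chart_at q.
have tX : to_chart A (chart_at A q) q (X q) = X q by exact: to_chart_at.
move: (chart_at A q) Ac cq tX => c Ac cq tX.
have dX := vf_rep_differentiable hA q sX Ac cq.
have dZ := vf_rep_differentiable hA q sZ Ac cq.
have df := fun_rep_differentiable hA q sf Ac cq.
have E1 := derive_linear_dir (f q) (X q) 0 dZ.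
rewrite addr0 derive0 addr0 in E1.
have E2 : 'D_(Z q) (vf_rep A c q (fun p => f p *: X p)) (cmap c q)
  = f q *: 'D_(Z q) (vf_rep A c q X) (cmap c q)
    + 'D_(Z q) (f \o cinv c q) (cmap c q) *: X q.
  have sfX : smooth_vf A (fscale f X) by exact: smooth_fscale.
  apply/rowP => j; rewrite derive_coord; last exact: vf_rep_differentiable.
  apply: etrans _ (esym (rV_combE _ _ _ _ j)).
  rewrite (derive_coord (Z q) j dX).
  have dXj : differentiable (fun z => vf_rep A c q X z 0 j) (cmap c q).
    apply: (Cinf_differentiable (open_img hA Ac)); last exact: in_img.
    exact: ((smooth_vfP A X).1 sX c q Ac j).
  have := deriveM (diff_derivable df (v := Z q)) (diff_derivable dXj).
  rewrite /= (cinvK hA)// (vf_repE hA)// tX => E.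
  rewrite [X in _ + X]mulrC -[RHS]E; apply: near_eq_derive.
  apply: (near_overlap hA Ac Ac cq cq) => q' cq' _.
  have -> : forall g h : 'rV[R]_m -> R, (g * h) (cmap c q') = g (cmap c q') * h (cmap c q') by [].
  by rewrite /= (cinvK hA)// !(vf_repE hA)// (to_chartZ hA)// mxE.
by apply: etrans (congr2 (fun a b => a - b) E1 E2) _; rewrite scalerBr opprD addrA.
Qed.

Lemma vf_act_bracket X Y f : smooth_vf A X -> smooth_vf A Y -> smooth_fun A f ->
  vf_act A (bracket A X Y) f = vf_act A X (vf_act A Y f) - vf_act A Y (vf_act A X f).
Proof.
move=> sX sY sf; apply/funext => q; rewrite subfE.
have Ac := chart_atP q; have cq := in_chart_at q.
have tW W : to_chart A (chart_at A q) q (W q) = W q by exact: to_chart_at.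
have B := bracket_chart hA q sX sY Ac cq; rewrite (tW X) (tW Y) (tW (bracket A X Y)) in B.
rewrite !vf_actE B.
move: (chart_at A q) Ac cq tW {B} => c Ac cq tW.
have RX : vf_rep A c q X (cmap c q) = X q by rewrite (vf_repE hA)// tW.
have RY : vf_rep A c q Y (cmap c q) = Y q by rewrite (vf_repE hA)// tW.
have oI := open_img hA Ac.
have CX := (smooth_vfP A X).1 sX c q Ac; have CY := (smooth_vfP A Y).1 sY c q Ac.
have := derive_commutator oI (smooth_funP q sf Ac) CX CY (in_img cq).
rewrite RX RY => <-.
have E W : \forall z \near cmap c q,
    (vf_act A W f \o cinv c q) z = 'D_(vf_rep A c q W z) (f \o cinv c q) z.
  apply: (near_overlap hA Ac Ac cq cq) => q' cq' _.
  by rewrite /= (cinvK hA)// (vf_repE hA)//; exact: vf_act_chart.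
by apply/esym; apply: (congr2 (fun a b => a - b)); apply: near_eq_derive; exact: E.
Qed.

(** Computed in one chart: the components of each double bracket are differences
    of third-order expressions, of the form a derivation applied to a derivation
    applied to a component, which cancel in the cyclic sum. *)
Lemma jacobi X Y Z : smooth_vf A X -> smooth_vf A Y -> smooth_vf A Z ->
  bracket A X (bracket A Y Z) + bracket A Y (bracket A Z X)
  + bracket A Z (bracket A X Y) = 0.
Proof.
move=> sX sY sZ; apply/funext => q; rewrite !addfE.
have Ac := chart_atP q; have cq := in_chart_at q.
have tv v : to_chart A (chart_at A q) q v = v by exact: to_chart_at.
move: (chart_at A q) Ac cq tv => c Ac cq tv.
pose L W (g : 'rV[R]_m -> R) z := 'D_(vf_rep A c q W z) g z.
pose co W j z : R := vf_rep A c q W z 0 j.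
pose z0 := cmap c q.
have oI := open_img hA Ac.
have CW W : smooth_vf A W -> Cinf_map (cmap c @` cdom c) (vf_rep A c q W).
  by move=> sW; exact: (smooth_vfP A W).1 sW c q Ac.
have LB W (a b : 'rV[R]_m -> R) : Cinf (cmap c @` cdom c) a ->
    Cinf (cmap c @` cdom c) b -> L W (fun z => a z - b z) z0 = L W a z0 - L W b z0.
  move=> Ca Cb; apply: deriveB; apply: diff_derivable.
    exact: (Cinf_differentiable oI Ca (in_img cq)).
  exact: (Cinf_differentiable oI Cb (in_img cq)).
have B0 V W j q' : smooth_vf A V -> smooth_vf A W -> cdom c q' ->
    co (bracket A V W) j (cmap c q') = L V (co W j) (cmap c q') - L W (co V j) (cmap c q').
  move=> sV sW cq'.
  have dV := vf_rep_differentiable hA q sV Ac cq'.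
  have dW := vf_rep_differentiable hA q sW Ac cq'.
  rewrite /co (vf_repE hA)// (bracket_chart hA q sV sW Ac cq') rV_subE /L.
  rewrite (vf_repE hA q V Ac cq') (vf_repE hA q W Ac cq').
  exact: (congr2 (fun a b => a - b) (derive_coord _ j dW) (derive_coord _ j dV)).
have BB U V W j : smooth_vf A U -> smooth_vf A V -> smooth_vf A W ->
    co (bracket A U (bracket A V W)) j z0 =
    (L U (L V (co W j)) z0 - L U (L W (co V j)) z0)
    - (L V (L W (co U j)) z0 - L W (L V (co U j)) z0).
  move=> sU sV sW; have sVW := smooth_bracket sV sW.
  apply: etrans (B0 _ _ _ _ sU sVW cq) _; apply: (congr2 (fun a b => a - b)).
    have C1 : Cinf (cmap c @` cdom c) (L V (co W j)).
      exact: Cinf_derive oI (CW _ sW j) (CW _ sV).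
    have C2 : Cinf (cmap c @` cdom c) (L W (co V j)).
      exact: Cinf_derive oI (CW _ sV j) (CW _ sW).
    apply: etrans _ (LB U _ _ C1 C2).
    apply: near_eq_derive; apply: (near_overlap hA Ac Ac cq cq) => q' cq' _.
    exact: B0.
  apply: etrans _ (esym (derive_commutator oI (CW _ sU j) (CW _ sV) (CW _ sW) (in_img cq))).
  rewrite /L (vf_repE hA q (bracket A V W) Ac cq) (bracket_chart hA q sV sW Ac cq).
  by rewrite (vf_repE hA q V Ac cq) (vf_repE hA q W Ac cq).
have fin W : smooth_vf A W -> forall j, W q 0 j = co W j z0.
  by move=> sW j; rewrite /co /z0 (vf_repE hA)// tv.
have sXYZ := smooth_bracket sX (smooth_bracket sY sZ).
have sYZX := smooth_bracket sY (smooth_bracket sZ sX).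
have sZXY := smooth_bracket sZ (smooth_bracket sX sY).
have cyc (a b d e g h : R) :
    (a - b - (d - e)) + (d - g - (h - b)) + (h - e - (a - g)) = 0 by ring.
apply/rowP => j; have E (u v w : 'rV[R]_m) : (u + v + w) 0 j = u 0 j + v 0 j + w 0 j.
  by rewrite !mxE.
have EX := etrans (fin _ sXYZ j) (BB _ _ _ j sX sY sZ).
have EY := etrans (fin _ sYZX j) (BB _ _ _ j sY sZ sX).
have EZ := etrans (fin _ sZXY j) (BB _ _ _ j sZ sX sY).
apply: etrans (E _ _ _) _.
apply: etrans (congr2 (fun a b => a + b) (congr2 (fun a b => a + b) EX EY) EZ) _.
by rewrite [RHS]mxE; exact: cyc.
Qed.

End Fields.

(** * Extension of fields by zero and bump functions on a manifold *)

Section Extension.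
Variables (R : realType) (T : choiceType) (m : nat) (A : atlas R T m).
Hypothesis hA : coord_atlas A.

(** Vanishing near the points that lie outside of the chart, nearness being
    tested through the other charts. *)
Definition supported_in (c : chart R T m) (f : T -> R) :=
  forall c' q, charts A c' -> cdom c' q -> ~ cdom c q ->
    exists O : set 'rV[R]_m, [/\ open O, O (cmap c' q) &
      forall q', cdom c' q' -> O (cmap c' q') -> f q' = 0].

Definition zero_extension (c : chart R T m) (f : T -> R)
    (G : 'rV[R]_m -> 'rV[R]_m) : vfield R T m := fun q =>
  if pselect (cdom c q) then f q *: of_chart A c q (G (cmap c q)) else 0.

Lemma zero_extensionE c f G q : charts A c -> cdom c q ->
  to_chart A c q (zero_extension c f G q) = f q *: G (cmap c q).
Proof.
move=> Ac cq; rewrite /zero_extension; case: pselect => //= ?.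
by rewrite (to_chartZ hA)// (of_chartK hA).
Qed.

Lemma zero_extension_smooth c f G : charts A c -> smooth_fun A f ->
  supported_in c f -> Cinf_map (cmap c @` cdom c) G ->
  smooth_vf A (zero_extension c f G).
Proof.
move=> Ac sf supp sG; apply/smooth_vfP => c' p Ac' j.
apply: Cinf_local => _ [q c'q <-].
have [cq|ncq] := pselect (cdom c q); last first.
  have [ O [oO Oq fO]] := supp _ _ Ac' c'q ncq.
  exists (O `&` (cmap c' @` cdom c')); first by split => //; exists q.
  have oOI : open (O `&` (cmap c' @` cdom c')) by apply: openI => //; exact: (open_img hA).
  apply: (Cinf_ext oOI _ (Cinf_cst _ 0)) => z [Oz [q' c'q' qz]].
  rewrite -qz in Oz *; rewrite (vf_repE hA)// /zero_extension.
  by case: pselect => /= ?; rewrite ?(fO q')// ?scale0r (to_chart0 hA)// mxE.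
exists (overlap c' c); first exact: overlapE.
have oO := ca_open hA Ac' Ac; have oO' := ca_open hA Ac Ac'.
pose H z := 'D_(G z) (transition c c' q) z.
have sub : overlap c c' `<=` cmap c @` cdom c by move=> _ [q' [? _] <-]; exists q'.
have CH : Cinf_map (overlap c c') H.
  apply: Cinf_map_derive oO' _ (Cinf_map_sub sub sG).
  exact: (ca_transition hA).
have sub' : overlap c' c `<=` cmap c' @` cdom c' by move=> _ [q' [? _] <-]; exists q'.
have CHt : Cinf_map (overlap c' c) (H \o transition c' c q).
  apply: (Cinf_map_comp oO oO' _ _ CH); last exact: (ca_transition hA).
  by move=> _ [q' [? ?] <-]; rewrite (transitionE hA)//; exact: overlapE.
have Cf : Cinf (overlap c' c) (f \o cinv c' q).
  exact: Cinf_sub sub' (smooth_funP q sf Ac').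
apply: (Cinf_ext oO _ (CinfM oO Cf (CHt j))) => _ [q' [c'q' cq'] <-].
rewrite /= (cinvK hA)// (transitionE hA)// (vf_repE hA)//.
rewrite (to_chart_change hA q _ Ac Ac' cq' c'q') zero_extensionE//.
rewrite /H; have d := transition_differentiable hA q Ac Ac' cq' c'q'.
have := derive_linear_dir (f q') (G (cmap c q')) 0 d.
by rewrite derive0 !addr0 => ->; rewrite mxE.
Qed.

End Extension.

Section BaseBump.
Variables (R : realType) (M : topologicalType) (n : nat) (A : atlas R M n).
Hypothesis hM : smooth_manifold A.

Lemma manifold_coord_atlas : coord_atlas A.
Proof.
split.
- exact: sm_chart_at.
- exact: sm_cdom_at.
- by move=> c q q' Ac cq cq'; apply: (sm_inj hM Ac); exact: mem_set.
- move=> c c' Ac Ac'; apply: (sm_open_map hM Ac); last exact: subIsetl.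
  by apply: openI; exact: (sm_cdom_open hM).
- by move=> c c' p Ac Ac' j k; exact: (sm_transition hM).
Qed.

Let hA := manifold_coord_atlas.

(** The support lies in the image of a closed ball of the chart, hence compact, hence
    closed in the Hausdorff space [M]; this is what makes the extension by zero
    smooth at the boundary of the chart. *)
Lemma exists_bump c x : charts A c -> cdom c x ->
  exists f : M -> R, [/\ f x = 1, smooth_fun A f &
    forall y, ~ cdom c y -> exists V : set M, [/\ open V, V y &
      forall y', V y' -> f y' = 0]].
Proof.
move=> Ac cx; have oI := open_img hA Ac; pose z0 := cmap c x.
have /nbhs_ballP[r0 /= r00 r0I] : nbhs z0 (cmap c @` cdom c).
  by apply: open_nbhs_nbhs; split => //; exists x.
pose r := r0 / 2; have rp : 0 < r by rewrite divr_gt0.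
pose B : set 'rV[R]_n := closed_ball_ Num.norm z0 r.
have BI : B `<=` cmap c @` cdom c.
  move=> z Bz; apply: r0I; rewrite -ball_normE /=.
  by apply: le_lt_trans Bz _; rewrite ltr_pdivrMr// ltr_pMr// ltr1n.
pose K : set M := cinv c x @` B.
have Kclosed : closed K.
  apply: compact_closed; first exact: (sm_hausdorff hM).
  apply: continuous_compact.
    apply: continuous_in_subspaceT => z; rewrite inE => /BI [y cy <-] V.
    rewrite (cinvK hA)// nbhsE => -[V' [oV' V'y] V'V].
    have oVc : open (V' `&` cdom c) by apply: openI => //; exact: (sm_cdom_open hM).
    have : nbhs (cmap c y) (cmap c @` (V' `&` cdom c)).
      apply: open_nbhs_nbhs; split; last by exists y.
      by apply: (sm_open_map hM Ac oVc); exact: subIsetr.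
    by apply: filterS => _ [y' [V'y' cy'] <-]; apply: V'V; rewrite (cinvK hA).
  apply: bounded_closed_compact; last exact: closed_closed_ball_.
  exists (`|z0| + r); split; first by rewrite num_real.
  move=> a ar z Bz; rewrite /= -(subrK z0 z) (le_trans (ler_normD _ _))// addrC.
  by rewrite (le_trans _ (ltW ar))// lerD2l distrC.
pose f y := if pselect (cdom c y) then cutoff z0 r (cmap c y) else 0.
have f0 y : ~ K y -> f y = 0.
  move=> nKy; rewrite /f; case: pselect => //= cy.
  apply: cutoff_eq0 => //; rewrite ltNge; apply/negP => le; apply: nKy.
  by exists (cmap c y); [rewrite /B /closed_ball_ /= distrC|exact: (cinvK hA)].
have nbhs0 y : ~ cdom c y -> exists V : set M, [/\ open V, V y &
    forall y', V y' -> f y' = 0].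
  move=> ncy; exists (~` K); split; [exact: closed_openC| |by move=> y' /f0].
  move=> [z /BI [y' cy' <-]]; rewrite (cinvK hA)// => y'y.
  by apply: ncy; rewrite -y'y.
exists f; split=> //.
  by rewrite /f; case: pselect => //= ?; exact: cutoff_center.
move=> k c' p Ac'.
suff : Cinf (cmap c' @` cdom c') (f \o cinv c' p) by exact.
apply: Cinf_local => _ [y c'y <-].
have [cy|ncy] := pselect (cdom c y).
  exists (overlap c' c); first exact: overlapE.
  have oO := ca_open hA Ac' Ac.
  apply: (@Cinf_ext _ _ _ (cutoff z0 r \o transition c' c x)) => //.
    move=> _ [y' [c'y' cy'] <-]; rewrite /= (transitionE hA)// (cinvK hA)//.
    by rewrite /f; case: pselect.
  apply: (Cinf_comp oO openT _ _ (Cinf_cutoff z0 r openT)) => //.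
  exact: (ca_transition hA).
have [V [oV Vy V0]] := nbhs0 y ncy.
exists (cmap c' @` (V `&` cdom c')); first by exists y.
have oO : open (cmap c' @` (V `&` cdom c')).
  apply: (sm_open_map hM Ac'); last exact: subIsetr.
  by apply: openI => //; exact: (sm_cdom_open hM).
apply: (Cinf_ext oO _ (Cinf_cst _ 0)) => _ [y' [Vy' c'y'] <-].
by rewrite /= (cinvK hA)// V0.
Qed.

End BaseBump.

(** * The slit tangent bundle *)

Section Slit.
Variables (R : realType) (M : topologicalType) (n : nat) (A : atlas R M n).
Hypothesis hM : smooth_manifold A.
Let hA := manifold_coord_atlas hM.
Notation slit := (slit R M n).
Implicit Types (c : chart R M n) (u : slit).

Definition base u : M := (val u).1.
Definition fiber u : 'rV[R]_n := (val u).2.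

Lemma slit_cmapE c u :
  cmap (slit_chart A c) u = row_mx (cmap c (base u)) (to_chart A c (base u) (fiber u)).
Proof. by []. Qed.

Lemma lsub_cmap c u : lsubmx (cmap (slit_chart A c) u) = cmap c (base u).
Proof. exact: row_mxKl. Qed.

Lemma rsub_cmap c u :
  rsubmx (cmap (slit_chart A c) u) = to_chart A c (base u) (fiber u).
Proof. exact: row_mxKr. Qed.

(** The change of induced charts: the pair of a change of charts and of its
    differential. *)
Definition tangent_transition c c' (p : M) (z : 'rV[R]_(n + n)) : 'rV[R]_(n + n) :=
  row_mx (transition c c' p (lsubmx z))
         ('D_(rsubmx z) (transition c c' p) (lsubmx z)).

Lemma tangent_transitionE c c' p u : charts A c -> charts A c' ->
  cdom c (base u) -> cdom c' (base u) ->
  tangent_transition c c' p (cmap (slit_chart A c) u) = cmap (slit_chart A c') u.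
Proof.
move=> Ac Ac' cu c'u.
rewrite /tangent_transition lsub_cmap rsub_cmap (slit_cmapE c').
apply: (congr2 row_mx); first exact: (transitionE hA).
exact/esym/(to_chart_change hA).
Qed.

Lemma slit_inj c u u' : charts A c -> cdom c (base u) -> cdom c (base u') ->
  cmap (slit_chart A c) u = cmap (slit_chart A c) u' -> u = u'.
Proof.
move=> Ac cu cu'; rewrite !slit_cmapE => /eq_row_mx[e1 e2]; apply: val_inj.
have := ca_inj hA Ac cu cu' e1.
case: u u' cu cu' {e1} e2 => [[x y] hu] [[x' y'] hu']; rewrite /base /fiber /=.
move=> cx _ e2 xx'; rewrite -xx' in e2 *; congr pair.
by rewrite -(to_chartK hA y Ac cx) e2 (to_chartK hA).
Qed.

Lemma open_neq0 m : open [set w : 'rV[R]_m | w != 0].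
Proof.
rewrite (_ : mkset _ = Num.norm @^-1` [set a : R | 0 < a]).
  apply: open_comp; last exact: open_gt.
  by move=> w _; exact: norm_continuous.
by apply/seteqP; split=> w /=; rewrite normr_gt0.
Qed.

Lemma slit_overlapE c c' : charts A c -> charts A c' ->
  overlap (slit_chart A c) (slit_chart A c') =
  [set z | overlap c c' (lsubmx z) /\ rsubmx z != 0].
Proof.
move=> Ac Ac'; apply/seteqP; split=> z.
  move=> [u [cu c'u] <-]; rewrite /= lsub_cmap rsub_cmap; split.
    by exists (base u).
  apply/eqP => H; have fib0 : fiber u = 0.
    have := to_chartK hA (fiber u) Ac cu; rewrite H => <-.
    by have := to_chartK hA 0 Ac cu; rewrite (to_chart0 hA).
  by have := valP u; rewrite /= -/(fiber u) fib0 eqxx.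
case=> [[x [cx c'x] ex] nz].
have nz' : of_chart A c x (rsubmx z) != 0.
  apply/eqP => H; move/eqP: nz; apply.
  by rewrite -(of_chartK hA (rsubmx z) Ac cx) H (to_chart0 hA).
exists (exist _ (x, of_chart A c x (rsubmx z)) nz'); first by split.
by rewrite slit_cmapE /base /fiber /= (of_chartK hA)// ex hsubmxK.
Qed.

Lemma slit_overlap_open c c' : charts A c -> charts A c' ->
  open (overlap (slit_chart A c) (slit_chart A c')).
Proof.
move=> Ac Ac'; rewrite slit_overlapE//.
rewrite (_ : mkset _ = (lsubmx @^-1` overlap c c')
   `&` (rsubmx @^-1` [set w : 'rV[R]_n | w != 0]))//.
apply: openI.
  apply: open_comp; last exact: (ca_open hA).
  by move=> z _; exact: continuous_lsubmx.
apply: open_comp; last exact: open_neq0.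
by move=> z _; exact: continuous_rsubmx.
Qed.

Lemma Cinf_lsubmx (U : set 'rV[R]_(n + n)) : Cinf_map U lsubmx.
Proof.
move=> j; have := @Cinf_coord R _ U (lshift n j).
by congr (Cinf _ _); apply/funext => z; rewrite mxE.
Qed.

Lemma Cinf_rsubmx (U : set 'rV[R]_(n + n)) : Cinf_map U rsubmx.
Proof.
move=> j; have := @Cinf_coord R _ U (rshift n j).
by congr (Cinf _ _); apply/funext => z; rewrite mxE.
Qed.

Lemma Cinf_row_mx m (U : set 'rV[R]_m) (f g : 'rV[R]_m -> 'rV[R]_n) :
  Cinf_map U f -> Cinf_map U g -> Cinf_map U (fun z => row_mx (f z) (g z)).
Proof.
move=> Cf Cg j; case: (splitP j) => i ji.
  have := Cf i; congr (Cinf _ _); apply/funext => z.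
  by rewrite (_ : j = lshift n i) ?row_mxEl//; exact: val_inj.
have := Cg i; congr (Cinf _ _); apply/funext => z.
by rewrite (_ : j = rshift n i) ?row_mxEr//; exact: val_inj.
Qed.

Lemma Cinf_map0 m p (U : set 'rV[R]_m) : Cinf_map U (fun=> 0 : 'rV[R]_p).
Proof. by move=> j; exact: Cinf_cst. Qed.

Lemma derive_lsubmx (z v : 'rV[R]_(n + n)) : 'D_v (lsubmx : _ -> 'rV[R]_n) z = lsubmx v.
Proof. by apply: derive_affine => h; rewrite addrC linearD linearZ. Qed.

Lemma tangent_transition_smooth c c' p : charts A c -> charts A c' ->
  Cinf_map (overlap (slit_chart A c) (slit_chart A c')) (tangent_transition c c' p).
Proof.
move=> Ac Ac'; have oO := slit_overlap_open Ac Ac'; have oO' := ca_open hA Ac Ac'.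
have Ct := ca_transition hA p Ac Ac'.
have sub z : overlap (slit_chart A c) (slit_chart A c') z -> overlap c c' (lsubmx z).
  by rewrite slit_overlapE//= => -[].
have Ctl : Cinf_map (overlap (slit_chart A c) (slit_chart A c'))
    (transition c c' p \o lsubmx).
  exact: Cinf_map_comp oO oO' sub (Cinf_lsubmx _) Ct.
apply: Cinf_row_mx => //.
have CX := Cinf_row_mx (Cinf_rsubmx (overlap (slit_chart A c) (slit_chart A c'))) (Cinf_map0 _).
apply: (Cinf_map_ext oO _ (Cinf_map_derive oO Ctl CX)) => z Oz.
have dt : differentiable (transition c c' p) (lsubmx z).
  exact: Cinf_map_differentiable oO' Ct (sub _ Oz).
apply: etrans (chain_rule _ (differentiable_lsubmx z) dt) _.
apply: (congr1 (fun w => 'D_w (transition c c' p) (lsubmx z))).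
exact: etrans (derive_lsubmx _ _) (row_mxKl _ _).
Qed.

Lemma slit_cinvK c p u : charts A c -> cdom c (base u) ->
  cinv (slit_chart A c) p (cmap (slit_chart A c) u) = u.
Proof.
move=> Ac cu; apply: cinv_cmap => // u' cu' e.
exact: (slit_inj Ac cu' cu e).
Qed.

Lemma slit_coord_atlas : coord_atlas (slit_atlas A).
Proof.
split.
- by move=> u; exists (chart_at A (base u)) => //; exact: (ca_chart_at hA).
- by move=> u; exact: (ca_cdom_at hA).
- by move=> _ u u' [c Ac <-]; exact: slit_inj.
- by move=> _ _ [c Ac <-] [c' Ac' <-]; exact: slit_overlap_open.
- move=> _ _ p [c Ac <-] [c' Ac' <-].
  apply: (Cinf_map_ext (slit_overlap_open Ac Ac') _
    (tangent_transition_smooth (base p) Ac Ac')) => _ [u [cu c'u] <-].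
  rewrite /transition (slit_cinvK p Ac cu); exact: tangent_transitionE.
Qed.

Let hS := slit_coord_atlas.

Lemma slit_charts c : charts A c -> charts (slit_atlas A) (slit_chart A c).
Proof. by move=> Ac; exists c. Qed.

Lemma slit_to_chart c u v : charts A c -> cdom c (base u) ->
  to_chart (slit_atlas A) (slit_chart A c) u v =
  'D_v (tangent_transition (chart_at A (base u)) c (base u))
       (cmap (slit_chart A (chart_at A (base u))) u).
Proof.
move=> Ac cu; set c0 := chart_at A (base u).
have Ac0 : charts A c0 by exact: (ca_chart_at hA).
have c0u : cdom c0 (base u) by exact: (ca_cdom_at hA).
have E := to_chart_change hS u v (slit_charts Ac0) (slit_charts Ac) c0u cu.
have Ev : to_chart (slit_atlas A) (slit_chart A c0) u v = v by exact: (to_chart_at hS).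
apply: etrans E _; rewrite Ev; apply: near_eq_derive.
apply: (near_overlap hS (slit_charts Ac0) (slit_charts Ac) c0u cu) => u' c0u' cu'.
apply: etrans (transitionE hS _ _ (slit_charts Ac0) c0u') _.
exact/esym/tangent_transitionE.
Qed.

(** A change of induced charts is linear along the fibres. *)
Lemma slit_to_chart_vertical c u w : charts A c -> cdom c (base u) ->
  to_chart (slit_atlas A) (slit_chart A c) u (row_mx 0 w) =
  row_mx 0 (to_chart A c (base u) w).
Proof.
move=> Ac cu; rewrite slit_to_chart//.
have Ac0 : charts A (chart_at A (base u)) by exact: (ca_chart_at hA).
have c0u : cdom (chart_at A (base u)) (base u) by exact: (ca_cdom_at hA).
have -> : to_chart A c (base u) w = 'D_w (transition (chart_at A (base u)) c (base u))
    (cmap (chart_at A (base u)) (base u)).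
  apply: etrans (to_chart_change hA (base u) w Ac0 Ac c0u cu) _.
  by rewrite (to_chart_at hA).
apply: derive_affine => h; rewrite /tangent_transition.
have El (z : 'rV[R]_(n + n)) : lsubmx (h *: row_mx (0 : 'rV[R]_n) w + z) = lsubmx z.
  by rewrite -[z]hsubmxK scale_row_mx add_row_mx !row_mxKl scaler0 add0r.
have Er (z : 'rV[R]_(n + n)) : rsubmx (h *: row_mx (0 : 'rV[R]_n) w + z) = h *: w + rsubmx z.
  by rewrite -[z]hsubmxK scale_row_mx add_row_mx !row_mxKr.
rewrite El Er lsub_cmap.
rewrite derive_linear_dir; last exact: (transition_differentiable hA).
by rewrite scale_row_mx add_row_mx scaler0 addr0 addrC.
Qed.

(** The projection onto [M] intertwines the changes of charts. *)
Lemma slit_to_chart_lsubmx c u v : charts A c -> cdom c (base u) ->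
  lsubmx (to_chart (slit_atlas A) (slit_chart A c) u v) =
  to_chart A c (base u) (lsubmx v).
Proof.
move=> Ac cu; rewrite slit_to_chart//.
have Ac0 : charts A (chart_at A (base u)) by exact: (ca_chart_at hA).
have c0u : cdom (chart_at A (base u)) (base u) by exact: (ca_cdom_at hA).
apply: etrans _ (esym (to_chart_change hA (base u) _ Ac0 Ac c0u cu)).
rewrite (to_chart_at hA).
set z0 := cmap (slit_chart A _) u; set G := tangent_transition _ _ _.
have dG : differentiable G z0.
  apply: (Cinf_map_differentiable (slit_overlap_open Ac0 Ac)).
    exact: tangent_transition_smooth.
  by exists u.
set t := transition (chart_at A (base u)) c (base u).
have lz0 : lsubmx z0 = cmap (chart_at A (base u)) (base u) by exact: lsub_cmap.
have dt : differentiable t (lsubmx z0).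
  by rewrite lz0; exact: (transition_differentiable hA).
have lG : lsubmx \o G = t \o lsubmx.
  by apply/funext => z; exact: row_mxKl.
apply: etrans (esym (derive_lsubmx (G z0) _)) _.
apply: etrans (esym (chain_rule v dG (differentiable_lsubmx (G z0)))) _.
rewrite lG; apply: etrans (chain_rule v (differentiable_lsubmx z0) dt) _.
by rewrite derive_lsubmx lz0.
Qed.

End Slit.

(** * The vertical endomorphism *)

Section VerticalEndo.
Variables (R : realType) (M : topologicalType) (n : nat) (A : atlas R M n).
Hypothesis hM : smooth_manifold A.
Let hA := manifold_coord_atlas hM.
Let hS := slit_coord_atlas hM.
Notation slit := (slit R M n).
Notation field := (vfield R slit (n + n)).
Notation SA := (slit_atlas A).
Notation smooth := (smooth_vf SA).
Notation J := (@vertical_endo R M n).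
Notation "[[ X , Y ]]" := (bracket SA X Y) (at level 0).
Implicit Types (X Y Z W : field) (u : slit).

(** The vertical endomorphism at one point, in any induced chart. *)
Definition jvec (w : 'rV[R]_(n + n)) : 'rV[R]_(n + n) := row_mx 0 (lsubmx w).

Lemma jvec_linear a w w' : jvec (a *: w + w') = a *: jvec w + jvec w'.
Proof. by rewrite /jvec linearP scale_row_mx add_row_mx scaler0 addr0. Qed.

Lemma jvec0 : jvec 0 = 0.
Proof. by rewrite /jvec linear0 row_mx0. Qed.

Lemma jvecZ a w : jvec (a *: w) = a *: jvec w.
Proof. by have := jvec_linear a w 0; rewrite jvec0 !addr0. Qed.

Lemma jvecD w w' : jvec (w + w') = jvec w + jvec w'.
Proof. by have := jvec_linear 1 w w'; rewrite !scale1r. Qed.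

Lemma jvecN w : jvec (- w) = - jvec w.
Proof. by rewrite -scaleN1r jvecZ scaleN1r. Qed.

Lemma jvec_jvec w : jvec (jvec w) = 0.
Proof. by rewrite /jvec row_mxKl row_mx0. Qed.

Lemma jvec_subr w w' : jvec (w - jvec w') = jvec w.
Proof. by rewrite jvecD jvecN jvec_jvec subr0. Qed.

Lemma jvec_subl w w' : jvec (jvec w - w') = - jvec w'.
Proof. by rewrite jvecD jvecN jvec_jvec sub0r. Qed.

Lemma vertical_endoE X u : J X u = jvec (X u).
Proof. by []. Qed.

Lemma vertical_endoD X Y : J (X + Y) = J X + J Y.
Proof. by apply/funext => u; exact: jvecD. Qed.

Lemma vertical_endoN X : J (- X) = - J X.
Proof. by apply/funext => u; exact: jvecN. Qed.

Lemma vertical_endoB X Y : J (X - Y) = J X - J Y.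
Proof. by rewrite vertical_endoD vertical_endoN. Qed.

Lemma vertical_endo_sq X : J (J X) = 0.
Proof. by apply/funext => u; exact: jvec_jvec. Qed.

Lemma vertical_endo_fscale f X : J (fscale f X) = fscale f (J X).
Proof. by apply/funext => u; exact: jvecZ. Qed.

Lemma vertical_endo_liouville : J (@liouville R M n) = 0.
Proof. by apply/funext => u; rewrite vertical_endoE /jvec row_mxKl row_mx0. Qed.

(** The components of the vertical endomorphism are the same in all induced
    charts. *)
Lemma to_chart_jvec c u w : charts A c -> cdom c (base u) ->
  to_chart SA (slit_chart A c) u (jvec w) = jvec (to_chart SA (slit_chart A c) u w).
Proof.
move=> Ac cu; rewrite /jvec (slit_to_chart_vertical hM)//.
by rewrite (slit_to_chart_lsubmx hM).
Qed.

Lemma Cinf_jvec m (U : set 'rV[R]_m) f : Cinf_map U f -> Cinf_map U (jvec \o f).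
Proof.
move=> Cf; apply: Cinf_row_mx; first exact: Cinf_map0.
move=> j; have := Cf (lshift n j).
by congr (Cinf _ _); apply/funext => z; rewrite mxE.
Qed.

Lemma smooth_vertical_endo X : smooth X -> smooth (J X).
Proof.
move=> sX; apply: (smooth_vf_ext hS (G := fun c p => jvec \o vf_rep SA c p X)).
  by move=> c p Ac; apply: Cinf_jvec; exact: (smooth_vfP SA X).1 sX c p Ac.
move=> _ p u [c Ac <-] cu; rewrite /= (vf_repE hS)//; last exact: slit_charts.
exact: to_chart_jvec.
Qed.

Lemma smooth_liouville : smooth (@liouville R M n).
Proof.
apply: (smooth_vf_ext hS (G := fun c p z => row_mx 0 (rsubmx z))).
  by move=> c p Ac; apply: Cinf_row_mx; [exact: Cinf_map0|exact: Cinf_rsubmx].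
move=> _ p u [c Ac <-] cu; rewrite rsub_cmap.
exact: (slit_to_chart_vertical hM).
Qed.

Lemma derive_jvec m (f : 'rV[R]_m -> 'rV[R]_(n + n)) x w : differentiable f x ->
  'D_w (jvec \o f) x = jvec ('D_w f x).
Proof.
move=> df; have dj y : differentiable jvec y.
  apply: (@Cinf_map_differentiable _ _ _ setT) => //; first exact: openT.
  apply: (@Cinf_jvec _ setT id) => j; exact: Cinf_coord.
apply: etrans (chain_rule w df (dj _)) _.
by apply: derive_affine => h; rewrite jvec_linear addrC.
Qed.

Opaque vertical_endo.

(** The vertical endomorphism has constant coefficients in every induced chart,
    hence its Nijenhuis torsion vanishes. *)
Lemma nijenhuis_vertical X Y : smooth X -> smooth Y ->
  [[J X, J Y]] = J [[J X, Y]] + J [[X, J Y]].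
Proof.
move=> sX sY; apply/funext => u.
apply: etrans _ (esym (addfE (J [[J X, Y]]) (J [[X, J Y]]) u)).
have Ac : charts A (chart_at A (base u)) by exact: (ca_chart_at hA).
have cu : cdom (chart_at A (base u)) (base u) by exact: (ca_cdom_at hA).
have E Z W : [[Z, W]] u =
    'D_(Z u) (vf_rep SA (slit_chart A (chart_at A (base u))) u W)
      (cmap (slit_chart A (chart_at A (base u))) u)
    - 'D_(W u) (vf_rep SA (slit_chart A (chart_at A (base u))) u Z)
      (cmap (slit_chart A (chart_at A (base u))) u) by exact: bracketE.
move: (chart_at A (base u)) Ac cu E => c Ac cu E.
have Ac' := slit_charts Ac.
have DJ W w : smooth W ->
    'D_w (vf_rep SA (slit_chart A c) u (J W)) (cmap (slit_chart A c) u)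
    = jvec ('D_w (vf_rep SA (slit_chart A c) u W) (cmap (slit_chart A c) u)).
  move=> sW; apply: etrans _ (derive_jvec _ (vf_rep_differentiable hS u sW Ac' cu)).
  apply: near_eq_derive; apply: (near_overlap hS Ac' Ac' cu cu) => u' cu' _.
  rewrite /= (vf_repE hS u (J W) Ac' cu') (vf_repE hS u W Ac' cu').
  exact: to_chart_jvec.
have EJ : [[J X, J Y]] u = jvec ('D_(J X u) (vf_rep SA (slit_chart A c) u Y)
      (cmap (slit_chart A c) u)) - jvec ('D_(J Y u) (vf_rep SA (slit_chart A c) u X)
      (cmap (slit_chart A c) u)).
  by apply: etrans (E _ _) _; exact: (congr2 (fun a b => a - b) (DJ _ _ sY) (DJ _ _ sX)).
have EX : J [[J X, Y]] u = jvec ('D_(J X u) (vf_rep SA (slit_chart A c) u Y)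
      (cmap (slit_chart A c) u)).
  have H := etrans (E (J X) Y) (congr1 (fun t => _ - t) (DJ X (Y u) sX)).
  apply: (etrans (congr1 jvec H)); exact: (jvec_subr _ _).
have EY : J [[X, J Y]] u = - jvec ('D_(J Y u) (vf_rep SA (slit_chart A c) u X)
      (cmap (slit_chart A c) u)).
  have H := etrans (E X (J Y)) (congr1 (fun t => t - _) (DJ Y (X u) sY)).
  apply: (etrans (congr1 jvec H)); exact: (jvec_subl _ _).
exact: etrans EJ (esym (congr2 (fun a b => a + b) EX EY)).
Qed.

(** In the chart, [W] is the image under [J] of the field whose first components
    are the fibre components of [W]; a bump function extends this field to the
    whole bundle. *)
Lemma vertical_local W u : smooth W -> J W = 0 ->
  exists f Y, [/\ smooth_fun SA f, smooth Y, f u = 1 & fscale f W = J Y].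
Proof.
move=> sW JW.
have Ac : charts A (chart_at A (base u)) by exact: (ca_chart_at hA).
have cu : cdom (chart_at A (base u)) (base u) by exact: (ca_cdom_at hA).
move: (chart_at A (base u)) Ac cu => c Ac cu.
have Ac' := slit_charts Ac.
have [b [bu sb b0] ] := exists_bump hM Ac cu.
pose f (u' : slit) := b (base u').
have sf : smooth_fun SA f.
  suff H c1 p : charts A c1 -> Cinf (cmap (slit_chart A c1) @` cdom (slit_chart A c1))
      (f \o cinv (slit_chart A c1) p).
    by move=> k _ p [c1 Ac1 <-]; exact: H.
  move=> Ac1; have oI := open_img hS (slit_charts Ac1).
  apply: (@Cinf_ext _ _ _ ((b \o cinv c1 (base p)) \o lsubmx)) => //.
    move=> _ [u' cu' <-]; rewrite /= (slit_cinvK hM)// lsub_cmap (cinvK hA)//.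
  apply: Cinf_comp oI (open_img hA Ac1) _ (Cinf_lsubmx _) (smooth_funP _ sb Ac1).
  by move=> _ [u' cu' <-]; rewrite lsub_cmap; exists (base u').
have supp : supported_in SA (slit_chart A c) f.
  move=> _ u1 [c1 Ac1 <-] c1u1 ncu1; have [V [oV Vu1 V0] ] := b0 _ ncu1.
  exists (lsubmx @^-1` (cmap c1 @` (V `&` cdom c1))); split.
  - apply: open_comp; first by move=> z _; exact: continuous_lsubmx.
    apply: (sm_open_map hM Ac1); last exact: subIsetr.
    by apply: openI; [exact: oV|exact: (sm_cdom_open hM Ac1)].
  - by exists (base u1); [split|exact/esym/lsub_cmap].
  - move=> u2 c1u2 /=; rewrite lsub_cmap => -[x [Vx c1x] xu2].
    by have xE := ca_inj hA Ac1 c1x c1u2 xu2; rewrite xE in Vx; exact: V0.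
pose G z : 'rV[R]_(n + n) := row_mx (rsubmx (vf_rep SA (slit_chart A c) u W z)) 0.
have CG : Cinf_map (cmap (slit_chart A c) @` cdom (slit_chart A c)) G.
  apply: Cinf_row_mx; last exact: Cinf_map0.
  move=> j; have := (smooth_vfP SA W).1 sW _ u Ac' (rshift n j).
  by congr (Cinf _ _); apply/funext => z; rewrite mxE.
exists f, (zero_extension SA (slit_chart A c) f G).
split; [exact: sf|exact: (zero_extension_smooth hS Ac' sf supp CG)|exact: bu|].
apply/funext => u'; rewrite vertical_endoE.
have [cu'|ncu'] := pselect (cdom c (base u')); last first.
  rewrite /fscale /zero_extension; case: pselect => /= [cu'|_]; first by [].
  have [V [_ Vu' V0] ] := b0 _ ncu'.
  by rewrite jvec0 /f V0// scale0r.
have tW : to_chart SA (slit_chart A c) u' (W u')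
    = row_mx 0 (rsubmx (to_chart SA (slit_chart A c) u' (W u'))).
  rewrite -[LHS]hsubmxK (slit_to_chart_lsubmx hM)//.
  have /(congr1 (fun X => rsubmx (X u'))) := JW.
  rewrite vertical_endoE /jvec row_mxKr => ->.
  by rewrite linear0 (to_chart0 hA).
have inj w w' : to_chart SA (slit_chart A c) u' w = to_chart SA (slit_chart A c) u' w' ->
    w = w'.
  by move=> e; rewrite -(to_chartK hS w Ac' cu') e (to_chartK hS).
apply: inj; rewrite to_chart_jvec// (zero_extensionE hS)//.
rewrite (to_chartZ hS _ _ Ac' cu') jvecZ; congr (_ *: _).
by rewrite /G (vf_repE hS)// /jvec row_mxKl.
Qed.

End VerticalEndo.

(** * The algebra of the Chern connection *)

(** [V] stands for the fields and [C] for the functions, [smooth] singling out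
    the smooth fields; [br] is the bracket, [act] the derivation of functions.
    The form [m X Z] stands for [g(X, JZ)], so that the h-curvature with lowered
    index is [m (R(X, Y) Z) W]. *)
Record chern_algebra (V C : zmodType) (smooth : V -> Prop)
    (br : V -> V -> V) (J h v : V -> V) (D : V -> V -> V)
    (act : V -> C -> C) (m : V -> V -> C) : Prop := {
  al_smooth0 : smooth 0 ;
  al_smoothB : forall X Y, smooth X -> smooth Y -> smooth (X - Y) ;
  al_smooth_br : forall X Y, smooth X -> smooth Y -> smooth (br X Y) ;
  al_smooth_J : forall X, smooth X -> smooth (J X) ;
  al_smooth_h : forall X, smooth X -> smooth (h X) ;
  al_smooth_v : forall X, smooth X -> smooth (v X) ;
  al_smooth_D : forall X Y, smooth X -> smooth Y -> smooth (D X Y) ;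
  al_brC : forall X Y, br X Y = - br Y X ;
  al_brDr : forall X Y Z, smooth X -> smooth Y -> smooth Z ->
    br X (Y + Z) = br X Y + br X Z ;
  al_jacobi : forall X Y Z, smooth X -> smooth Y -> smooth Z ->
    br X (br Y Z) + br Y (br Z X) + br Z (br X Y) = 0 ;
  al_JD : forall X Y, J (X + Y) = J X + J Y ;
  al_hv : forall X, X = h X + v X ;
  al_Jv : forall X, smooth X -> J (v X) = 0 ;
  al_DDl : forall X Y Z, smooth X -> smooth Y -> smooth Z ->
    D (X + Y) Z = D X Z + D Y Z ;
  al_DDr : forall X Y Z, smooth X -> smooth Y -> smooth Z ->
    D X (Y + Z) = D X Y + D X Z ;
  al_DJ : forall X Y, smooth X -> smooth Y -> D X (J Y) = J (D X Y) ;
  al_D_vertical : forall W Z, smooth W -> J W = 0 -> smooth Z ->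
    D W (J Z) = J (br W Z) ;
  al_torsion : forall X Y, smooth X -> smooth Y ->
    J (D (h X) (h Y) - D (h Y) (h X) - br (h X) (h Y)) = 0 ;
  al_mDl : forall X Y Z, smooth X -> smooth Y -> smooth Z ->
    m (X + Y) Z = m X Z + m Y Z ;
  al_m_sym : forall X Y, smooth X -> smooth Y -> m (J X) Y = m (J Y) X ;
  al_metric : forall X Y Z, smooth X -> smooth Y -> smooth Z ->
    act (h X) (m (J Y) Z) = m (D (h X) (J Y)) Z + m (J Y) (D (h X) Z) ;
  al_act_mD : forall X Y Z Y' Z', smooth X ->
    smooth Y -> smooth Z -> smooth Y' -> smooth Z' ->
    act X (m Y Z + m Y' Z') = act X (m Y Z) + act X (m Y' Z') ;
  al_act_br : forall X Y Z W, smooth X -> smooth Y -> smooth Z -> smooth W ->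
    act (br X Y) (m Z W) = act X (act Y (m Z W)) - act Y (act X (m Z W)) }.

Section Additive.
Variables (V V' : zmodType) (P : V -> Prop) (f : V -> V').
Hypotheses (P0 : P 0) (PB : forall x y, P x -> P y -> P (x - y))
  (fD : forall x y, P x -> P y -> f (x + y) = f x + f y).

Lemma additive_on0 : f 0 = 0.
Proof. by apply: (addrI (f 0)); rewrite -fD// !addr0. Qed.

Lemma additive_onB x y : P x -> P y -> f (x - y) = f x - f y.
Proof.
by move=> Px Py; rewrite -[in RHS](subrK y x) [in RHS]fD ?addrK//; exact: PB.
Qed.

Lemma additive_onN x : P x -> f (- x) = - f x.
Proof. by move=> Px; rewrite -[- x]sub0r additive_onB// additive_on0 sub0r. Qed.

End Additive.

Section ChernAlgebra.
Variables (V C : zmodType) (smooth : V -> Prop)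
    (br : V -> V -> V) (J h v : V -> V) (D : V -> V -> V)
    (act : V -> C -> C) (m : V -> V -> C).
Hypothesis H : chern_algebra smooth br J h v D act m.
Implicit Types X Y Z W U P Q : V.

Let s0 := al_smooth0 H.
Let sB := al_smoothB H.
Let sbr := al_smooth_br H.
Let sJ := al_smooth_J H.
Let sh := al_smooth_h H.
Let sv := al_smooth_v H.
Let sD := al_smooth_D H.
#[local] Hint Resolve s0 sB sbr sJ sh sv sD al_Jv : core.

Definition hcurv X Y Z : V :=
  D (h X) (D (h Y) (J Z)) - D (h Y) (D (h X) (J Z)) - D (br (h X) (h Y)) (J Z).

Lemma smooth_hcurv X Y Z : smooth X -> smooth Y -> smooth Z ->
  smooth (hcurv X Y Z).
Proof.
move=> sX sY sZ; have := (sh sX, sh sY, sJ sZ) => -[[shX shY] sJZ].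
by apply: sB; [apply: sB|]; apply: sD => //; [apply: sD|apply: sD|apply: sbr].
Qed.

Lemma conn0r X : smooth X -> D X 0 = 0.
Proof. by move=> sX; apply: (additive_on0 s0) => *; exact: (al_DDr H). Qed.

Lemma connBr X Y Z : smooth X -> smooth Y -> smooth Z ->
  D X (Y - Z) = D X Y - D X Z.
Proof. by move=> sX; apply: (additive_onB sB) => *; exact: (al_DDr H). Qed.

Lemma connNl X Z : smooth X -> smooth Z -> D (- X) Z = - D X Z.
Proof.
move=> sX sZ; apply: (@additive_onN _ _ smooth (fun X => D X Z)) => //.
by move=> *; exact: (al_DDl H).
Qed.

Lemma J0 : J 0 = 0.
Proof. by apply: (@additive_on0 _ _ (fun=> True)) => // *; exact: (al_JD H). Qed.

Lemma JB X Y : J (X - Y) = J X - J Y.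
Proof. by apply: (@additive_onB _ _ (fun=> True)) => // *; exact: (al_JD H). Qed.

Lemma JN X : J (- X) = - J X.
Proof. by rewrite -[- X]sub0r JB J0 sub0r. Qed.

Lemma J_h X : smooth X -> J (h X) = J X.
Proof. by move=> sX; rewrite [in RHS](al_hv H X) (al_JD H) (al_Jv H)// addr0. Qed.

Lemma J_br_vertical U W : smooth U -> smooth W -> J U = 0 -> J W = 0 ->
  J (br U W) = 0.
Proof. by move=> sU sW JU JW; rewrite -(al_D_vertical H)// JW conn0r. Qed.

Lemma conn_symmetric X U : smooth X -> smooth U ->
  D (h X) (J U) - D (h U) (J X) = J (br (h X) (h U)).
Proof.
move=> sX sU; have [shX shU] := (sh sX, sh sU).
rewrite -(J_h sX) -(J_h sU) !(al_DJ H)//.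
by apply/subr0_eq; rewrite -!JB (al_torsion H).
Qed.

(** The vertical part of the bracket differentiates [JZ] as a Lie bracket, and
    only the horizontal part of [Z] contributes to it. *)
Lemma hcurvE X Y Z : smooth X -> smooth Y -> smooth Z ->
  hcurv X Y Z = D (h X) (D (h Y) (J Z)) - D (h Y) (D (h X) (J Z))
    - (D (h (br (h X) (h Y))) (J Z) + J (br (v (br (h X) (h Y))) (h Z))).
Proof.
move=> sX sY sZ; have [[shX shY] sJZ] := (sh sX, sh sY, sJ sZ).
have sXY := sbr shX shY; rewrite /hcurv; congr (_ - _).
have JvXY := al_Jv H sXY; have JvZ := al_Jv H sZ.
rewrite {1}(al_hv H (br _ _)) (al_DDl H); auto; congr (_ + _).
rewrite (al_D_vertical H); auto.
rewrite {1}(al_hv H Z) (al_brDr H); auto; rewrite (al_JD H).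
by rewrite (@J_br_vertical _ (v Z)) ?addr0; auto.
Qed.

(** The telescoping behind the Bianchi identity: the [ai] are second covariant
    derivatives, the [di] and [bi] the contributions of the horizontal and
    vertical parts of the brackets, the [ji] double brackets. *)
Lemma sum_cyclic (a1 a2 a3 a4 a5 a6 d1 d2 d3 b1 b2 b3 t1 t2 t3 j1 j2 j3 : V) :
  a1 - a6 = t1 -> a3 - a2 = t2 -> a5 - a4 = t3 ->
  t1 - d2 = j1 + b2 -> t2 - d3 = j2 + b3 -> t3 - d1 = j3 + b1 ->
  j1 + j2 + j3 = 0 ->
  (a1 - a2 - (d1 + b1)) + (a3 - a4 - (d2 + b2)) + (a5 - a6 - (d3 + b3)) = 0.
Proof.
have move_over (x y z : V) : x - y = z -> x = z + y by move=> <-; rewrite subrK.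
move=> /move_over-> /move_over-> /move_over-> /move_over-> /move_over->
  /move_over-> j0.
rewrite !opprD !addrA.
(* The first three terms are the cyclic sum, the others cancel in pairs; the
   numbers are the positions of the terms from the left. *)
rewrite [LHS](ACl ((1*8*15)*(2*14)*(3*13)*(4*19)*(11*5)*(17*6)*(16*7)*(9*21)
  *(10*20)*(18*12))).
by rewrite /= j0 !subrr !addr0.
Qed.

(** The mixed terms [q] and [r], in which one derivative falls on each argument
    of the metric, cancel in the commutator. *)
Lemma sum_metric (p p' q r s s' b b' : C) :
  b + b' = p + q + (r + s) - (p' + r + (q + s')) ->
  p - p' - b + (s - s' - b') = 0.
Proof.
move=> e; rewrite addrACA -opprD e; apply/eqP; rewrite subr_eq0; apply/eqP.
rewrite !opprD !addrA [RHS](ACl (1*5*4*8*(2*7)*(3*6))).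
by rewrite /= !subrr !addr0.
Qed.

(** Regrouping by the direction of the outer derivative, [conn_symmetric] turns
    the difference of two second derivatives into [D_hX (J [hY, hZ])], and, once
    more, [D_hX (J B) - D_hB (JX)] into [J [hX, hB]] with [B = [hY, hZ]]. *)
Lemma hcurv_bianchi X Y Z : smooth X -> smooth Y -> smooth Z ->
  hcurv X Y Z + hcurv Y Z X + hcurv Z X Y = 0.
Proof.
move=> sX sY sZ; have [[shX shY] shZ] := (sh sX, sh sY, sh sZ).
have swap P Q W : smooth P -> smooth Q -> smooth W ->
    D (h P) (D (h Q) (J W)) - D (h P) (D (h W) (J Q)) = D (h P) (J (br (h Q) (h W))).
  move=> sP sQ sW; rewrite -(conn_symmetric sQ sW) connBr; auto.
have split_br P Q W : smooth P -> smooth Q -> smooth W ->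
    D (h P) (J (br (h Q) (h W))) - D (h (br (h Q) (h W))) (J P) =
    J (br (h P) (br (h Q) (h W))) + J (br (v (br (h Q) (h W))) (h P)).
  move=> sP sQ sW; have sQW := sbr (sh sQ) (sh sW).
  rewrite conn_symmetric// (al_brC H (v _)) JN -JB.
  by rewrite {2}(al_hv H (br (h Q) _)) (al_brDr H) ?addrK; auto.
rewrite !hcurvE//.
apply: (sum_cyclic (swap X Y Z _ _ _) (swap Y Z X _ _ _) (swap Z X Y _ _ _)
  (split_br X Y Z _ _ _) (split_br Y Z X _ _ _) (split_br Z X Y _ _ _)) => //.
by rewrite -!(al_JD H) (al_jacobi H)// J0.
Qed.

Lemma hcurv_antisym X Y Z : smooth X -> smooth Y -> smooth Z ->
  hcurv X Y Z = - hcurv Y X Z.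
Proof.
move=> sX sY sZ; rewrite /hcurv (al_brC H) connNl; [|exact: sbr (sh sY) (sh sX)|exact: sJ].
by rewrite !opprB opprK [RHS]addrC.
Qed.

Let m0l Z : smooth Z -> m 0 Z = 0.
Proof.
by move=> sZ; apply: (@additive_on0 _ _ smooth (fun X => m X Z)) => // *; exact: (al_mDl H).
Qed.

Let mBl X Y Z : smooth X -> smooth Y -> smooth Z -> m (X - Y) Z = m X Z - m Y Z.
Proof.
move=> sX sY sZ; apply: (@additive_onB _ _ smooth (fun X => m X Z)) => // *.
exact: (al_mDl H).
Qed.

Let mBr X Y Z : smooth X -> smooth Y -> smooth Z ->
  m (J X) (Y - Z) = m (J X) Y - m (J X) Z.
Proof.
move=> sX sY sZ; rewrite (al_m_sym H); auto; rewrite JB mBl; auto.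
by rewrite (al_m_sym H sX sY) (al_m_sym H sX sZ).
Qed.

Definition curv4 X Y Z W : C := m (hcurv X Y Z) W.

Lemma curv4_antisym12 X Y Z W : smooth X -> smooth Y -> smooth Z -> smooth W ->
  curv4 X Y Z W = - curv4 Y X Z W.
Proof.
move=> sX sY sZ sW; rewrite /curv4 hcurv_antisym//.
apply: (@additive_onN _ _ smooth (fun X => m X W)) => //; last exact: smooth_hcurv.
by move=> *; exact: (al_mDl H).
Qed.

Lemma curv4_bianchi X Y Z W : smooth X -> smooth Y -> smooth Z -> smooth W ->
  curv4 X Y Z W + curv4 Y Z X W + curv4 Z X Y W = 0.
Proof.
move=> sX sY sZ sW; have sHXYZ := smooth_hcurv sX sY sZ.
have sHYZX := smooth_hcurv sY sZ sX; have sHZXY := smooth_hcurv sZ sX sY.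
have sDD U P : smooth U -> smooth P -> smooth (U + P).
  by move=> sU sP; rewrite -[P]opprK -[- P]sub0r; apply: (sB sU); exact: sB.
rewrite /curv4 -!(al_mDl H)//; last exact: sDD.
by rewrite hcurv_bianchi// m0l.
Qed.

Section Integrable.
Hypothesis horizontal : forall X Y, smooth X -> smooth Y ->
  br (h X) (h Y) = h (br (h X) (h Y)).

Lemma curv4_antisym34 X Y Z W : smooth X -> smooth Y -> smooth Z -> smooth W ->
  curv4 X Y Z W = - curv4 X Y W Z.
Proof.
move=> sX sY sZ sW; have [shX shY] := (sh sX, sh sY).
pose B := br (h X) (h Y); have sBr : smooth B by exact: sbr.
have BE : B = h B by exact: horizontal.
pose K U := D (h X) (D (h Y) U) - D (h Y) (D (h X) U) - D B U.
have KJ U : smooth U -> hcurv X Y U = J (K U).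
  by move=> sU; rewrite /hcurv /K !JB -!(al_DJ H); auto.
have metric2 P Q : smooth P -> smooth Q ->
    act (h P) (act (h Q) (m (J Z) W)) =
    m (D (h P) (D (h Q) (J Z))) W + m (D (h Q) (J Z)) (D (h P) W)
    + (m (D (h P) (J Z)) (D (h Q) W) + m (J Z) (D (h P) (D (h Q) W))).
  move=> sP sQ; have [shP shQ] := (sh sP, sh sQ).
  rewrite (al_metric H sQ)// (al_act_mD H); auto.
  rewrite (al_DJ H shQ sZ) (al_metric H sP (sD shQ sZ) sW).
  by rewrite (al_metric H sP sZ (sD shQ sW)).
have := al_act_br H shX shY (sJ sZ) sW.
rewrite -/B {1}BE (al_metric H sBr)// -BE !metric2//.
have E1 : curv4 X Y Z W = m (D (h X) (D (h Y) (J Z))) W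
    - m (D (h Y) (D (h X) (J Z))) W - m (D B (J Z)) W.
  by rewrite /curv4 /hcurv -/B !mBl; auto.
(* The symmetry of m turns K(hX, hY) JW in the first argument into
   K(hX, hY) W in the second one. *)
have E2 : curv4 X Y W Z = m (J Z) (D (h X) (D (h Y) W))
    - m (J Z) (D (h Y) (D (h X) W)) - m (J Z) (D B W).
  have sK : smooth (K W) by rewrite /K; auto 6.
  by rewrite /curv4 KJ// (al_m_sym H sK sZ) /K !mBr; auto 6.
move=> E; apply/eqP; rewrite -addr_eq0 E1 E2; apply/eqP.
exact: sum_metric E.
Qed.

End Integrable.
End ChernAlgebra.

(** The classical octahedron argument: combine the four Bianchi identities in
    which each of the four fields in turn is kept in the last place. *)
Lemma curvature_pair_symmetry (R : realFieldType) (T : Type) (V : Type)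
    (smooth : V -> Prop) (K : V -> V -> V -> V -> T -> R) :
  (forall X Y Z W, smooth X -> smooth Y -> smooth Z -> smooth W ->
    K X Y Z W = - K Y X Z W) ->
  (forall X Y Z W, smooth X -> smooth Y -> smooth Z -> smooth W ->
    K X Y Z W + K Y Z X W + K Z X Y W = 0) ->
  (forall X Y Z W, smooth X -> smooth Y -> smooth Z -> smooth W ->
    K X Y Z W = - K X Y W Z) ->
  forall X Y Z W, smooth X -> smooth Y -> smooth Z -> smooth W ->
    K X Y Z W = K Z W X Y.
Proof.
move=> a b c X Y Z W sX sY sZ sW; apply/funext => t.
have at_t (k k' : T -> R) : k = k' -> k t = k' t by move->.
have b1 := at_t _ _ (b _ _ _ _ sX sY sZ sW).
have b2 := at_t _ _ (b _ _ _ _ sY sZ sW sX).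
have b3 := at_t _ _ (b _ _ _ _ sZ sW sX sY).
have b4 := at_t _ _ (b _ _ _ _ sW sX sY sZ).
have c1 := at_t _ _ (c _ _ _ _ sY sZ sX sW).
have c2 := at_t _ _ (c _ _ _ _ sX sY sZ sW).
have c3 := at_t _ _ (c _ _ _ _ sZ sW sX sY).
have c4 := at_t _ _ (c _ _ _ _ sW sX sY sZ).
have c5 := at_t _ _ (c _ _ _ _ sX sZ sY sW).
have c6 := at_t _ _ (c _ _ _ _ sY sW sX sZ).
have a1 := at_t _ _ (a _ _ _ _ sX sZ sY sW).
have a2 := at_t _ _ (a _ _ _ _ sW sY sZ sX).
move: b1 b2 b3 b4 c1 c2 c3 c4 c5 c6 a1 a2; rewrite !fctE => *.
lra.
Qed.

(** * The Chern connection of a Finsler space *)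

Section Chern.
Variables (R : realType) (M : topologicalType) (n : nat) (A : atlas R M n).
Hypothesis hM : smooth_manifold A.
Let hS := slit_coord_atlas hM.
Notation slit := (slit R M n).
Notation field := (vfield R slit (n + n)).
Notation SA := (slit_atlas A).
Notation smooth := (smooth_vf SA).
Notation J := (@vertical_endo R M n).
Notation "[[ X , Y ]]" := (bracket SA X Y) (at level 0).
Implicit Types (X Y Z W U : field) (u : slit).

Variables (E : tangent R M n -> R) (S : field) (F : field -> field)
  (D : field -> field -> field).
Hypotheses (hE : finsler A E) (sS : smooth S) (hF : almost_complex A S F)
  (hD : chern_connection A E S F D).

Notation h := (hproj A S).
Notation v := (vproj A S).
Let e (u : slit) : R := E (val u).

Lemma smooth_energy : smooth_fun SA e.
Proof. exact: fin_smooth. Qed.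

Lemma smooth_barthel X : smooth X -> smooth (barthel A S X).
Proof.
move=> sX; have sJX := smooth_vertical_endo hM sX.
have s1 := smooth_bracket hS sS sJX.
have s2 := smooth_vertical_endo hM (smooth_bracket hS sS sX).
have s3 := smooth_vfN hS (smooth_vfB hS s1 s2).
exact: s3.
Qed.

Lemma smooth_hproj X : smooth X -> smooth (h X).
Proof.
by move=> sX; exact: (smooth_vfZ hS _ (smooth_vfD hS sX (smooth_barthel sX))).
Qed.

Lemma smooth_vproj X : smooth X -> smooth (v X).
Proof.
by move=> sX; exact: (smooth_vfZ hS _ (smooth_vfB hS sX (smooth_barthel sX))).
Qed.

Lemma hproj_vproj X : X = h X + v X.
Proof.
rewrite /hproj /vproj -scalerDr addrACA subrr addr0 scalerDr -scalerDl.
have -> : 2^-1 + 2^-1 = 1 :> R by lra.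
by rewrite scale1r.
Qed.

Opaque barthel hproj vproj.

Lemma smooth0 : smooth 0.
Proof. by have := smooth_vfB hS sS sS; rewrite subrr. Qed.

Let lc := ch_linear hD.
Let sJ := @smooth_vertical_endo _ _ _ _ hM.
Let sB := smooth_bracket hS.
Let sD X Y (sX : smooth X) (sY : smooth Y) : smooth (D X Y) := lc_smooth lc sX sY.

Lemma connection0 X : smooth X -> D X 0 = 0.
Proof. by move=> sX; exact: (additive_on0 smooth0 (fun Y Z => lc_addr lc sX)). Qed.

(** Since [D_X C = vX] and [D] commutes with [J], which kills the Liouville
    field [C]. *)
Lemma J_vproj X : smooth X -> J (v X) = 0.
Proof.
move=> sX; have sC := smooth_liouville hM.
rewrite -(ch_C hD sX) -(ch_J hD sX sC) vertical_endo_liouville.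
exact: connection0.
Qed.

Lemma J_hproj X : smooth X -> J (h X) = J X.
Proof.
move=> sX; rewrite [in RHS](hproj_vproj X) vertical_endoD.
by rewrite (J_vproj sX) addr0.
Qed.

(** Since [F J = h] and [J h = J]. *)
Lemma hproj_idem X : smooth X -> h (h X) = h X.
Proof.
move=> sX; have [_ FJ _] := hF.
by rewrite -(FJ _ (smooth_hproj sX)) (J_hproj sX) FJ.
Qed.

(** Multiplied by a bump function, [W] has the form [JY], for which the identity
    is an axiom of the connection.  Both sides are linear over functions in
    [W]: the term of the bracket in which the function is differentiated is
    a multiple of [W], which [J] kills. *)
Lemma conn_vertical W Z : smooth W -> J W = 0 -> smooth Z ->
  D W (J Z) = J [[W, Z]].
Proof.
move=> sW JW sZ; apply/funext => u.
have [f [Y [sf sY fu fW] ] ] := vertical_local hM u sW JW.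
have E1 : fscale f (D W (J Z)) = J [[fscale f W, Z]].
  by rewrite -(lc_scalel lc sf sW (sJ sZ)) fW (ch_vertical hD sY sZ).
rewrite (bracket_fscalel hS sf sW sZ) vertical_endoB !vertical_endo_fscale JW in E1.
have := congr1 (fun X => X u) E1.
by rewrite /fscale subfE fu !scale1r scaler0 subr0.
Qed.

Lemma OmegaE X Y : Omega A E X Y =
  vf_act SA X (vf_act SA (J Y) e) - vf_act SA Y (vf_act SA (J X) e)
  - vf_act SA (J [[X, Y]]) e.
Proof. by []. Qed.

Let smooth_act := smooth_vf_act hS.

Lemma smooth_Omega X Y : smooth X -> smooth Y -> smooth_fun SA (Omega A E X Y).
Proof.
move=> sX sY; rewrite OmegaE; have se := smooth_energy.
have s1 := smooth_act sX (smooth_act (sJ sY) se).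
have s2 := smooth_act sY (smooth_act (sJ sX) se).
have s3 := smooth_act (sJ (sB sX sY)) se.
exact: (smooth_funB hS (smooth_funB hS s1 s2) s3).
Qed.

Let actDl := vf_actDl hS.

Lemma OmegaDl X Y Z : smooth X -> smooth Y -> smooth Z ->
  Omega A E (X + Y) Z = Omega A E X Z + Omega A E Y Z.
Proof.
move=> sX sY sZ; have se := smooth_energy.
have E1 := actDl X Y (smooth_act (sJ sZ) se).
have E2 : vf_act SA Z (vf_act SA (J (X + Y)) e)
    = vf_act SA Z (vf_act SA (J X) e) + vf_act SA Z (vf_act SA (J Y) e).
  rewrite -(vf_actDr hS Z (smooth_act (sJ sX) se) (smooth_act (sJ sY) se)).
  by rewrite -(actDl (J X) (J Y) se) -vertical_endoD.
have E3 : vf_act SA (J [[X + Y, Z]]) e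
    = vf_act SA (J [[X, Z]]) e + vf_act SA (J [[Y, Z]]) e.
  rewrite -(actDl (J [[X, Z]]) (J [[Y, Z]]) se) -vertical_endoD.
  by rewrite -(bracketDl hS sX sY sZ).
have sum3 (C : zmodType) (p p' q q' r r' : C) :
    p + p' - (q + q') - (r + r') = p - q - r + (p' - q' - r').
  by rewrite !opprD !addrA [LHS](ACl (1*3*5*2*4*6)).
exact: etrans (congr2 (fun a b => a - b) (congr2 (fun a b => a - b) E1 E2) E3)
  (sum3 _ _ _ _ _ _ _).
Qed.

Lemma Omega_antisym X Y : Omega A E X Y = - Omega A E Y X.
Proof.
have E3 : vf_act SA (J [[X, Y]]) e = - vf_act SA (J [[Y, X]]) e.
  rewrite (bracketC SA X Y) vertical_endoN; exact: (vf_actNl hS _ smooth_energy).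
have sum3 (C : zmodType) (p q r : C) : p - q - - r = - (q - p - r).
  by rewrite !opprB opprK addrC.
exact: etrans (congr1 (fun b => _ - b) E3) (sum3 _ _ _ _).
Qed.

Opaque Omega.

Lemma OmegaDr X Y Z : smooth X -> smooth Y -> smooth Z ->
  Omega A E X (Y + Z) = Omega A E X Y + Omega A E X Z.
Proof.
move=> sX sY sZ; rewrite (Omega_antisym X (Y + Z)) (OmegaDl sY sZ sX) opprD.
exact: (congr2 (fun a b => a + b) (esym (Omega_antisym X Y)) (esym (Omega_antisym X Z))).
Qed.

Let m X Z : slit -> R := Omega A E X (h Z).

Lemma J_bracket_vertical V W : smooth V -> smooth W -> J V = 0 -> J W = 0 ->
  J [[V, W]] = 0.
Proof.
by move=> sV sW JV JW; rewrite -(conn_vertical sV JV sW) JW connection0.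
Qed.

(** The vertical distribution is Lagrangian: the one-form [dJE] vanishes on it and
    it is closed under brackets. *)
Lemma Omega_vertical V W : smooth V -> smooth W -> J V = 0 -> J W = 0 ->
  Omega A E V W = 0.
Proof.
move=> sV sW JV JW; rewrite OmegaE (J_bracket_vertical sV sW JV JW) JV JW.
by rewrite (vf_act0l SA e) !vf_act0 !subr0.
Qed.

Lemma Omega_J_hproj X Y : smooth X -> smooth Y ->
  m (J X) Y = Omega A E (J X) Y.
Proof.
move=> sX sY; rewrite /m {2}(hproj_vproj Y).
have shY := smooth_hproj sY; have svY := smooth_vproj sY.
rewrite (OmegaDr (sJ sX) shY svY).
rewrite (Omega_vertical (sJ sX) svY (vertical_endo_sq X) (J_vproj sY)).
by rewrite addr0.
Qed.

(** Up to terms that vanish, [m (JX) Y] is [JX(JY E) - (J[JX, Y])E].  The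
    difference of the two sides is thus [[JX, JY] - J[JX, Y] - J[X, JY]] applied
    to [E], which is zero because the Nijenhuis torsion of [J] is zero. *)
Lemma metric_symmetric X Y : smooth X -> smooth Y -> m (J X) Y = m (J Y) X.
Proof.
move=> sX sY; apply: etrans (Omega_J_hproj sX sY) _.
apply: etrans _ (esym (Omega_J_hproj sY sX)).
have se := smooth_energy.
have OE V W : Omega A E (J V) W = vf_act SA (J V) (vf_act SA (J W) e)
    - vf_act SA (J [[J V, W]]) e.
  rewrite OmegaE; have -> : vf_act SA W (vf_act SA (J (J V)) e) = 0.
    by rewrite vertical_endo_sq vf_act0l vf_act0.
  by rewrite subr0.
have N : vf_act SA [[J X, J Y]] e
    = vf_act SA (J [[J X, Y]]) e - vf_act SA (J [[J Y, X]]) e.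
  rewrite (nijenhuis_vertical hM sX sY) (bracketC SA X (J Y)) vertical_endoN.
  rewrite (actDl (J [[J X, Y]]) (- J [[J Y, X]]) se).
  by rewrite (vf_actNl hS (J [[J Y, X]]) se).
have B := vf_act_bracket hS (sJ sX) (sJ sY) se.
have swap (C : zmodType) (p q r s t : C) : t = r - s -> t = p - q -> p - r = q - s.
  move=> -> e'; have -> : p = r - s + q by rewrite e' subrK.
  by rewrite [LHS](ACl ((1*4)*(3*2))) /= subrr add0r.
rewrite (OE X Y).
rewrite (OE Y X).
exact: (@swap _ _ _ _ _ _ N B).
Qed.

Lemma metricE X Y : smooth Y -> gmetric A E F X (J Y) = m X Y.
Proof. by move=> sY; have [_ FJ _] := hF; rewrite /gmetric (FJ _ sY). Qed.

Lemma metric_compatible X Y Z : smooth X -> smooth Y -> smooth Z ->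
  vf_act SA (h X) (m (J Y) Z) = m (D (h X) (J Y)) Z + m (J Y) (D (h X) Z).
Proof.
move=> sX sY sZ; have shX := smooth_hproj sX.
have := ch_metric hD sX (sJ sY) (sJ sZ).
rewrite (metricE (J Y) sZ) (metricE _ sZ) (ch_J hD shX sZ).
by rewrite (metricE _ (sD shX sZ)).
Qed.

Lemma finsler_chern_algebra : chern_algebra smooth (bracket SA) J h v D (vf_act SA) m.
Proof.
have sm X Z : smooth X -> smooth Z -> smooth_fun SA (m X Z).
  by move=> sX sZ; exact: (smooth_Omega sX (smooth_hproj sZ)).
split.
- exact: smooth0.
- exact: (smooth_vfB hS).
- exact: sB.
- exact: sJ.
- exact: smooth_hproj.
- exact: smooth_vproj.
- exact: sD.
- exact: bracketC.
- exact: (bracketDr hS).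
- exact: (jacobi hS).
- exact: vertical_endoD.
- exact: hproj_vproj.
- exact: J_vproj.
- exact: (lc_addl lc).
- exact: (lc_addr lc).
- exact: (ch_J hD).
- exact: conn_vertical.
- exact: (ch_torsion hD).
- by move=> X Y Z sX sY sZ; exact: (OmegaDl sX sY (smooth_hproj sZ)).
- exact: metric_symmetric.
- exact: metric_compatible.
- move=> X Y Z Y' Z' sX sY sZ sY' sZ'.
  exact: (vf_actDr hS X (sm Y Z sY sZ) (sm Y' Z' sY' sZ')).
- move=> X Y Z W sX sY sZ sW.
  exact: (vf_act_bracket hS sX sY (sm Z W sZ sW)).
Qed.

Lemma hcurvature4E X Y Z W : smooth W ->
  hcurvature4 A E S F D X Y Z W = curv4 (bracket SA) J h D m X Y Z W.
Proof. by move=> sW; exact: metricE. Qed.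

(** For the fields [hX] and [hY] the Froelicher-Nijenhuis bracket [[h, h]]
    reduces to [2 (B - hB)] with [B = [hX, hY]], because [h] is idempotent. *)
Lemma horizontal_bracket X Y : smooth X -> smooth Y ->
  (forall X Y, smooth X -> smooth Y -> barthel_curvature A S X Y = 0) ->
  [[h X, h Y]] = h [[h X, h Y]].
Proof.
move=> sX sY flat; have [shX shY] := (smooth_hproj sX, smooth_hproj sY).
have sXY := sB shX shY.
(* All eight terms of the bracket of h with itself, with the iterated projections
   isolated in the arguments a, b and c. *)
pose g a b c : field := - (2^-1 *: ([[a, b]] + [[a, b]] + c + c
  - h [[a, h Y]] - h [[h X, b]] - h [[a, h Y]] - h [[h X, b]])).
have e1 : g (h (h X)) (h (h Y)) (h (h [[h X, h Y]])) = 0 by exact: flat.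
have e2 : g (h X) (h Y) (h [[h X, h Y]]) = 0.
  apply: etrans _ e1; apply: etrans (congr1 (g _ _) (esym (hproj_idem sXY))) _.
  exact: (congr2 (fun a b => g a b _) (esym (hproj_idem sX)) (esym (hproj_idem sY))).
have half (V : lmodType R) (b c : V) :
    - (2^-1 *: (b + b + c + c - c - c - c - c)) = c - b.
  have h1 : 2^-1 + 2^-1 = 1 :> R by lra.
  by rewrite !addrK -addrA -opprD scalerBr !scalerDr -!scalerDl h1 !scale1r opprB.
apply/esym; apply: subr0_eq; exact: etrans (esym (half _ _ _)) e2.
Qed.

End Chern.

Theorem proposition4p9 (R : realType) (n : nat) (M : topologicalType)
    (A : atlas R M n) (hM : smooth_manifold A)
    (E : tangent R M n -> R) (hE : finsler A E)
    (S : vfield R (slit R M n) (n + n)) (hS : canonical_spray A E S)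
    (F : vfield R (slit R M n) (n + n) -> vfield R (slit R M n) (n + n))
    (hF : almost_complex A S F)
    (D : vfield R (slit R M n) (n + n) -> vfield R (slit R M n) (n + n) ->
         vfield R (slit R M n) (n + n))
    (hD : chern_connection A E S F D) :
  let field := vfield R (slit R M n) (n + n) in
  let smooth := @smooth_vf R (slit R M n) (n + n) (slit_atlas A) in
  let Rst := hcurvature4 A E S F D in
  [/\ forall X Y Z W : field, smooth X -> smooth Y -> smooth Z -> smooth W ->
        Rst X Y Z W = - Rst Y X Z W,
      forall X Y Z W : field, smooth X -> smooth Y -> smooth Z -> smooth W ->
        Rst X Y Z W + Rst Y Z X W + Rst Z X Y W = 0
    & (forall X Y : field, smooth X -> smooth Y ->
         barthel_curvature A S X Y = 0) ->
      (forall X Y Z W : field, smooth X -> smooth Y -> smooth Z -> smooth W ->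
         Rst X Y Z W = - Rst X Y W Z) /\
      (forall X Y Z W : field, smooth X -> smooth Y -> smooth Z -> smooth W ->
         Rst X Y Z W = Rst Z W X Y)].
Proof.
move=> field smooth Rst; have sS := hS.1.
have H := finsler_chern_algebra hM hE sS hF hD.
have RE X Y Z W (sW : smooth W) := hcurvature4E E D hF X Y Z sW.
have a X Y Z W : smooth X -> smooth Y -> smooth Z -> smooth W ->
    Rst X Y Z W = - Rst Y X Z W.
  move=> sX sY sZ sW; rewrite /Rst (RE X Y Z W sW) (RE Y X Z W sW).
  exact: (curv4_antisym12 H sX sY sZ sW).
have b X Y Z W : smooth X -> smooth Y -> smooth Z -> smooth W ->
    Rst X Y Z W + Rst Y Z X W + Rst Z X Y W = 0.
  move=> sX sY sZ sW; rewrite /Rst (RE X Y Z W sW) (RE Y Z X W sW) (RE Z X Y W sW).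
  exact: (curv4_bianchi H sX sY sZ sW).
split; [exact: a|exact: b|move=> flat].
have hor X Y (sX : smooth X) (sY : smooth Y) := horizontal_bracket hM sS hF hD sX sY flat.
have c X Y Z W : smooth X -> smooth Y -> smooth Z -> smooth W ->
    Rst X Y Z W = - Rst X Y W Z.
  move=> sX sY sZ sW; rewrite /Rst (RE X Y Z W sW) (RE X Y W Z sZ).
  exact: (curv4_antisym34 H hor sX sY sZ sW).
split; [exact: c|exact: (curvature_pair_symmetry a b c)].
Qed.
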